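(* Let $\Lambda_\infty=(r_0=0,r_1,r_2,\dots)$ be a sequence of real numbers with $0<r_1<r_2<\cdots$ and $\lim_{n\to\infty} r_n=\infty$. Let $[a,b]\subset\,]0,\infty[$ with $a<b$, let $n\ge 1$, and let $P\in E(\Lambda_n)$ be a non-constant $\mathbb{R}^s$-valued element ($s\ge1$). Then the sequence of control polygons $\bigl(\eta_0(P,\Lambda_m,[a,b]),\dots,\eta_m(P,\Lambda_m,[a,b])\bigr)_{m\ge n}$ generated by dimension elevation converges uniformly to the curve $P$ on $[a,b]$ (in the sense defined in the context) if and only if $$\sum_{i=1}^{\infty}\frac{1}{r_i}=\infty .$$
   Context: For a sequence $0=r_0<r_1<r_2<\cdots$ of reals, write $\Lambda_n=(r_0,\dots,r_n)$ and $E(\Lambda_n)=\mathrm{span}(t^{r_0}=1,t^{r_1},\dots,t^{r_n})$ (functions on $]0,\infty[$); an $\mathbb{R}^s$-valued element of $E(\Lambda_n)$ is a map $t\mapsto\sum_{k=0}^n t^{r_k}A_k$ with $A_k\in\mathbb{R}^s$. Note $E(\Lambda_n)\subset E(\Lambda_m)$ for $m\ge n$. For an interval $[a,b]$ with $0<a<b$, the Chebyshev–Bernstein basis $(B^n_{0,\Lambda_n},\dots,B^n_{n,\Lambda_n})$ of $E(\Lambda_n)$ over $[a,b]$ is the unique basis of $E(\Lambda_n)$ with $\sum_{k=0}^n B^n_{k,\Lambda_n}\equiv 1$ such that, for each $k$, $B^n_{k,\Lambda_n}$ has a zero of multiplicity (exactly) $k$ at $a$ and of multiplicity $n-k$ at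 $b$. For $P\in E(\Lambda_n)$ and $m\ge n$, the control points $\eta_i(P,\Lambda_m,[a,b])\in\mathbb{R}^s$, $i=0,\dots,m$, are defined by $P(t)=\sum_{i=0}^m B^m_{i,\Lambda_m}(t)\,\eta_i(P,\Lambda_m,[a,b])$. Uniform convergence of the control polygons to $P$ on $[a,b]$ means: there exist parameters $a=t^m_0\le t^m_1\le\dots\le t^m_m=b$ such that $\max_i |t^m_{i+1}-t^m_i|\to0$ and $\max_{0\le i\le m}\|P(t^m_i)-\eta_i(P,\Lambda_m,[a,b])\|_\infty\to 0$ as $m\to\infty$. *)

(* Defs.v *)
From Stdlib Require Import Reals Lra Lia List.
Open Scope R_scope.

(* Exponent sequence r : nat -> R (r 0 = 0 < r 1 < r 2 < ...).
   Functions of E(Lambda_m) are represented by their coefficient vectors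
   c : nat -> R (only indices 0..m matter):  t |-> sum_{j=0}^m c j * t^(r j). *)

Definition muntz_fun (r : nat -> R) (m : nat) (c : nat -> R) (t : R) : R :=
  sum_f_R0 (fun j => c j * Rpower t (r j)) m.

Fixpoint falling (x : R) (p : nat) : R :=
  match p with
  | O => 1
  | S q => falling x q * (x - INR q)
  end.

(* p-th derivative of t |-> sum_j c j t^(r j) at t > 0 (exact formula:
   d^p/dt^p t^x = x(x-1)...(x-p+1) t^(x-p)). *)
Definition muntz_deriv (r : nat -> R) (m : nat) (c : nat -> R) (p : nat) (t : R) : R :=
  sum_f_R0 (fun j => c j * falling (r j) p * Rpower t (r j - INR p)) m.

Definition zero_mult_exact (r : nat -> R) (m : nat) (c : nat -> R) (x : R) (k : nat) : Prop :=
  (forall p, (p < k)%nat -> muntz_deriv r m c p x = 0) /\ muntz_deriv r m c k x <> 0.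

(* Bc k = coefficient vector of B^m_{k,Lambda_m}; (Bc 0,...,Bc m) is the
   Chebyshev-Bernstein basis of E(Lambda_m) over [a,b]. *)
Definition IsCBBasis (r : nat -> R) (a b : R) (m : nat) (Bc : nat -> nat -> R) : Prop :=
  (* linearly independent functions on ]0,oo[ (hence a basis, dim = m+1) *)
  (forall lam : nat -> R,
     (forall t, 0 < t -> sum_f_R0 (fun k => lam k * muntz_fun r m (Bc k) t) m = 0) ->
     forall k, (k <= m)%nat -> lam k = 0) /\
  (forall t, 0 < t -> sum_f_R0 (fun k => muntz_fun r m (Bc k) t) m = 1) /\
  (forall k, (k <= m)%nat ->
     zero_mult_exact r m (Bc k) a k /\ zero_mult_exact r m (Bc k) b (m - k)).

Definition norm_inf (s : nat) (v : nat -> R) : R :=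
  fold_right Rmax 0 (map (fun i => Rabs (v i)) (seq 0 s)).

Definition curve (r : nat -> R) (n : nat) (A : nat -> nat -> R) (t : R) : nat -> R :=
  fun i => sum_f_R0 (fun k => Rpower t (r k) * A k i) n.

Definition ctrl_poly_unif_conv (n : nat) (a b : R) (P : R -> nat -> R) (s : nat)
    (eta : nat -> nat -> nat -> R) : Prop :=
  exists tt : nat -> nat -> R,
    (forall m, (n <= m)%nat ->
       tt m O = a /\ tt m m = b /\ (forall i, (i < m)%nat -> tt m i <= tt m (S i))) /\
    (forall eps, 0 < eps -> exists N, forall m, (n <= m)%nat -> (N <= m)%nat ->
       (forall i, (i < m)%nat -> Rabs (tt m (S i) - tt m i) < eps) /\
       (forall i, (i <= m)%nat ->
          norm_inf s (fun c => P (tt m i) c - eta m i c) < eps)).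

(* Main.v *)
(** With [v = ln t] the Müntz functions are exponential sums [sum_j c_j e^{r_j v}], and Rolle's
    theorem bounds the number of their zeros. Differentiating after division by the lowest power
    maps a Chebyshev-Bernstein basis to one of the space with exponents [r_1, r_2, ...], which
    makes the control points [xi_i] of [t^{r_1}] increasing and, for [j >= 2], the polygon
    [(xi_i, eta_i)] of [(t^{r_1}, t^{r_j})] convex and below the curve. The operator
    [1 - (t d/dt) / r_m] kills the highest power instead; it shows that the control points over
    [[a, b]] are convex combinations of those over [[0, b]], which are explicit:
    [b^{r_j} prod_{l=k+1}^m (1 - r_j / r_l)].

    If [sum 1/r_i] diverges, the explicit points approach the curve uniformly, and so do the
    control points over [[a, b]], squeezed between them and the curve; strict convexity of
    [t^{r_2}] in [t^{r_1}] then forces the mesh of the nodes [xi_i^{1/r_1}] to zero.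

    If [sum 1/r_i] converges, the control points of [t^{r_j}] with index beyond some [K] are at
    least [b^{r_j} / 2] for all [m], so at [t < b] the Bernstein functions of index at least [K]
    have total mass at most [2 (t/b)^{r_j}], small for large [j]. Uniform convergence of the
    polygons makes the control points of each fixed index tend to [P(a)], hence [P = P(a)]. *)
Require Import Defs.
From Stdlib Require Import Reals Lra Lia List Classical ClassicalEpsilon.
Open Scope R_scope.

(** * Exponential sums and their zeros *)

(** A basis is normalised by sum B_k = e^{r_0 v}, which is the constant 1 only for r_0 = 0:
    [drop_low] leads to exponents starting at r_1, and the inductions through it need bases of the
    same kind there. [drop_high] keeps r_0 and compares level m + 1 with level m. It multiplies the
    coefficient of t^{r_j} by 1 - r_j / r_{m+1}, so lowering an element from level m to level k and
    reading its last control point, the value at b, yields the explicit points. Thus [0, b] enters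
    through a formula only, and no basis over it is built. In the divergent case t^{r_j} is compared
    with x^{r_j / r_1} at x = t^{r_1}: the tangent to this convex function at xi_i gives the lower
    bound for eta_i, the edge of the polygon leaving xi_i the upper one. *)

Lemma seq_choice (T : Type) (P : nat -> T -> Prop) :
  (forall k, exists x, P k x) -> exists f, forall k, P k (f k).
Proof.
  intros H. exists (fun k => proj1_sig (constructive_indefinite_description _ (H k))).
  intros k. exact (proj2_sig (constructive_indefinite_description _ (H k))).
Qed.

Lemma sum_swap (f : nat -> nat -> R) (n m : nat) :
  sum_f_R0 (fun i => sum_f_R0 (fun j => f i j) m) n =
  sum_f_R0 (fun j => sum_f_R0 (fun i => f i j) n) m.
Proof.
  induction n as [|n IH]; simpl; [reflexivity|].
  rewrite IH, <- plus_sum. reflexivity.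
Qed.

Lemma sum_scal_l (x : R) (f : nat -> R) (n : nat) :
  sum_f_R0 (fun i => x * f i) n = x * sum_f_R0 f n.
Proof. rewrite scal_sum. apply sum_eq; intros; ring. Qed.

Lemma sum_scal_r (x : R) (f : nat -> R) (n : nat) :
  sum_f_R0 (fun i => f i * x) n = sum_f_R0 f n * x.
Proof. rewrite Rmult_comm, scal_sum. reflexivity. Qed.

Lemma sum_split_first (f : nat -> R) (n : nat) :
  sum_f_R0 f (S n) = f O + sum_f_R0 (fun i => f (S i)) n.
Proof. rewrite decomp_sum by lia. reflexivity. Qed.

Lemma sum_single (f : nat -> R) (n k : nat) :
  (k <= n)%nat -> (forall i, (i <= n)%nat -> i <> k -> f i = 0) ->
  sum_f_R0 f n = f k.
Proof.
  intros Hk H. induction n as [|n IH].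
  - replace k with O by lia. reflexivity.
  - simpl. destruct (Nat.eq_dec k (S n)) as [->|Hne].
    + rewrite sum_eq_R0; [ring|]. intros i Hi. apply H; lia.
    + rewrite IH, (H (S n)); [ring|lia|lia|lia|]. intros i Hi Hik. apply H; lia.
Qed.

Lemma sum_pair (f : nat -> R) (n k : nat) :
  (k <= n)%nat -> (forall i, (i <= S n)%nat -> i <> k -> i <> S k -> f i = 0) ->
  sum_f_R0 f (S n) = f k + f (S k).
Proof.
  intros Hk H.
  rewrite (sum_eq _ (fun i => (if Nat.eq_dec i k then f i else 0)
                              + (if Nat.eq_dec i k then 0 else f i))).
  2:{ intros i _. destruct (Nat.eq_dec i k); ring. }
  rewrite plus_sum, (sum_single _ (S n) k), (sum_single _ (S n) (S k)); try lia.
  - destruct (Nat.eq_dec k k); [|lia]. destruct (Nat.eq_dec (S k) k); [lia|reflexivity].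
  - intros i Hi Hik. destruct (Nat.eq_dec i k); [reflexivity|]. apply H; lia.
  - intros i Hi Hik. destruct (Nat.eq_dec i k); [lia|reflexivity].
Qed.

Lemma sum_nonneg (f : nat -> R) (n : nat) :
  (forall i, (i <= n)%nat -> 0 <= f i) -> 0 <= sum_f_R0 f n.
Proof.
  intros H. rewrite <- (sum_eq_R0 (fun _ => 0) n) by reflexivity.
  apply sum_Rle; exact H.
Qed.

Definition strictly_incr (r : nat -> R) : Prop := forall i, r i < r (S i).

Definition unit_vec (i j : nat) : R := if Nat.eq_dec i j then 1 else 0.

Definition comb (lam : nat -> R) (b : nat -> nat -> R) (N : nat) : nat -> R :=
  fun j => sum_f_R0 (fun k => lam k * b k j) N.

(* With f(v) = sum_{j<=m} c_j e^{r_j v}, that is t^{r_j} at t = e^v, this is the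
   p-th derivative of f at v. *)
Definition mom (r : nat -> R) (m : nat) (c : nat -> R) (p : nat) (v : R) : R :=
  sum_f_R0 (fun j => c j * r j ^ p * exp (r j * v)) m.

Definition vanish (r : nat -> R) (m : nat) (c : nat -> R) (k : nat) (v : R) : Prop :=
  forall p, (p < k)%nat -> mom r m c p v = 0.

(* Coefficients of (d/dv - r_0) f, a member of the span with exponents r_1, ..., r_{m+1}. *)
Definition drop_low (r : nat -> R) (c : nat -> R) : nat -> R :=
  fun j => (r (S j) - r O) * c (S j).

(* Coefficients of (1 - (d/dv) / r_{m+1}) f, a member of the span with exponents r_0, ..., r_m. *)
Definition drop_high (r : nat -> R) (m : nat) (c : nat -> R) : nat -> R :=
  fun j => (1 - r j / r (S m)) * c j.

Lemma strictly_incr_lt (r : nat -> R) (i j : nat) :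
  strictly_incr r -> (i < j)%nat -> r i < r j.
Proof.
  intros Hr Hij. induction j as [|j IH]; [lia|].
  destruct (Nat.eq_dec i j) as [->|]; [apply Hr|].
  apply Rlt_trans with (r j); [apply IH; lia|apply Hr].
Qed.

Lemma strictly_incr_shift (r : nat -> R) : strictly_incr r -> strictly_incr (fun j => r (S j)).
Proof. intros H i. apply H. Qed.

Lemma sum_unit_vec (f : nat -> R) (i m : nat) :
  (i <= m)%nat -> sum_f_R0 (fun j => unit_vec i j * f j) m = f i.
Proof.
  intros Hi. rewrite (sum_single _ m i Hi).
  - unfold unit_vec. destruct (Nat.eq_dec i i); [ring|lia].
  - intros j _ Hj. unfold unit_vec. destruct (Nat.eq_dec i j); [lia|ring].
Qed.

Lemma mom_ext (r : nat -> R) (m : nat) (c d : nat -> R) (p : nat) (v : R) :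
  (forall j, (j <= m)%nat -> c j = d j) -> mom r m c p v = mom r m d p v.
Proof. intros H. apply sum_eq. intros j Hj. rewrite H by exact Hj. reflexivity. Qed.

Lemma mom_zero (r : nat -> R) (m : nat) (c : nat -> R) (p : nat) (v : R) :
  (forall j, (j <= m)%nat -> c j = 0) -> mom r m c p v = 0.
Proof. intros H. apply sum_eq_R0. intros j Hj. rewrite H by exact Hj. ring. Qed.

Lemma mom_plus (r : nat -> R) (m : nat) (c d : nat -> R) (p : nat) (v : R) :
  mom r m (fun j => c j + d j) p v = mom r m c p v + mom r m d p v.
Proof. unfold mom. rewrite <- plus_sum. apply sum_eq. intros; ring. Qed.

Lemma mom_scal (r : nat -> R) (m : nat) (x : R) (c : nat -> R) (p : nat) (v : R) :
  mom r m (fun j => x * c j) p v = x * mom r m c p v.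
Proof. unfold mom. rewrite <- sum_scal_l. apply sum_eq. intros; ring. Qed.

Lemma mom_comb (r : nat -> R) (m : nat) (lam : nat -> R) (b : nat -> nat -> R)
    (N p : nat) (v : R) :
  mom r m (comb lam b N) p v = sum_f_R0 (fun k => lam k * mom r m (b k) p v) N.
Proof.
  unfold mom, comb.
  rewrite (sum_eq _ (fun j => sum_f_R0
             (fun k => lam k * b k j * r j ^ p * exp (r j * v)) N)).
  2:{ intros j _. rewrite <- !sum_scal_r. reflexivity. }
  rewrite sum_swap. apply sum_eq. intros k _. rewrite <- sum_scal_l.
  apply sum_eq. intros; ring.
Qed.

Lemma mom_unit_vec (r : nat -> R) (m i p : nat) (v : R) :
  (i <= m)%nat -> mom r m (unit_vec i) p v = r i ^ p * exp (r i * v).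
Proof.
  intros Hi. unfold mom.
  rewrite (sum_eq _ (fun j => unit_vec i j * (r j ^ p * exp (r j * v)))) by (intros; ring).
  apply (sum_unit_vec (fun j => r j ^ p * exp (r j * v))). exact Hi.
Qed.

Lemma mom_drop_low (r : nat -> R) (m : nat) (c : nat -> R) (p : nat) (v : R) :
  mom (fun j => r (S j)) m (drop_low r c) p v =
  mom r (S m) c (S p) v - r O * mom r (S m) c p v.
Proof.
  unfold mom. rewrite !sum_split_first, Rmult_plus_distr_l, <- sum_scal_l.
  match goal with |- ?L = ?x + ?A - (?y + ?B) =>
    replace (x + A - (y + B)) with (A - B) by (simpl; ring) end.
  rewrite <- minus_sum. apply sum_eq. intros j _. unfold drop_low. simpl. ring.
Qed.

Lemma mom_drop_high (r : nat -> R) (m : nat) (c : nat -> R) (p : nat) (v : R) :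
  r (S m) <> 0 ->
  mom r m (drop_high r m c) p v =
  mom r (S m) c p v - mom r (S m) c (S p) v / r (S m).
Proof.
  intros Hr. unfold mom. rewrite !tech5. unfold Rdiv at 1.
  rewrite Rmult_plus_distr_r, <- sum_scal_r.
  match goal with |- ?L = ?A + ?x - (?B + ?y) =>
    replace (A + x - (B + y)) with (A - B) by (simpl; field; exact Hr) end.
  rewrite <- minus_sum. apply sum_eq. intros j _. unfold drop_high. simpl.
  unfold Rdiv. ring.
Qed.

Lemma derivable_pt_lim_mom (r : nat -> R) (m : nat) (c : nat -> R) (p : nat) (v : R) :
  derivable_pt_lim (mom r m c p) v (mom r m c (S p) v).
Proof.
  assert (Hterm : forall j, derivable_pt_lim (fun x => c j * r j ^ p * exp (r j * x)) v
                    (c j * r j ^ S p * exp (r j * v))).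
  { intros j.
    replace (c j * r j ^ S p * exp (r j * v))
      with (c j * r j ^ p * (exp (r j * v) * (r j * 1))) by (simpl; ring).
    apply (derivable_pt_lim_scal (fun x => exp (r j * x))).
    apply (derivable_pt_lim_comp (fun x => r j * x) exp).
    - apply (derivable_pt_lim_scal (fun x => x)). apply derivable_pt_lim_id.
    - apply derivable_pt_lim_exp. }
  unfold mom. induction m as [|m IH]; simpl sum_f_R0.
  - apply Hterm.
  - apply (derivable_pt_lim_plus
             (fun x => sum_f_R0 (fun j => c j * r j ^ p * exp (r j * x)) m)
             (fun x => c (S m) * r (S m) ^ p * exp (r (S m) * x))).
    + exact IH.
    + apply Hterm.
Qed.

Lemma continuity_mom (r : nat -> R) (m : nat) (c : nat -> R) (p : nat) :
  continuity (mom r m c p).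
Proof.
  intros v. apply derivable_continuous_pt.
  exists (mom r m c (S p) v). apply derivable_pt_lim_mom.
Qed.

Lemma vanish_drop_low (r : nat -> R) (m : nat) (c : nat -> R) (k : nat) (v : R) :
  vanish r (S m) c (S k) v -> vanish (fun j => r (S j)) m (drop_low r c) k v.
Proof.
  intros H p Hp. rewrite mom_drop_low, !H by lia. ring.
Qed.

Lemma vanish_drop_high (r : nat -> R) (m : nat) (c : nat -> R) (k : nat) (v : R) :
  r (S m) <> 0 -> vanish r (S m) c (S k) v -> vanish r m (drop_high r m c) k v.
Proof.
  intros Hr H p Hp. rewrite mom_drop_high, !H by (exact Hr || lia). field. exact Hr.
Qed.

Lemma vanish_le (r : nat -> R) (m : nat) (c : nat -> R) (k l : nat) (v : R) :
  (l <= k)%nat -> vanish r m c k v -> vanish r m c l v.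
Proof. intros Hl H p Hp. apply H. lia. Qed.

Lemma vanish_comb (r : nat -> R) (m : nat) (lam : nat -> R) (b : nat -> nat -> R)
    (N k : nat) (v : R) :
  (forall i, (i <= N)%nat -> lam i <> 0 -> vanish r m (b i) k v) ->
  vanish r m (comb lam b N) k v.
Proof.
  intros H p Hp. rewrite mom_comb. apply sum_eq_R0. intros i Hi.
  destruct (Req_dec (lam i) 0) as [H0|H0].
  - rewrite H0. ring.
  - rewrite (H i Hi H0 p Hp). ring.
Qed.

Lemma vanish_ext (r : nat -> R) (m : nat) (c d : nat -> R) (k : nat) (v : R) :
  (forall j, (j <= m)%nat -> c j = d j) -> vanish r m c k v -> vanish r m d k v.
Proof. intros H Hc p Hp. rewrite <- (mom_ext r m c d p v H). apply Hc; exact Hp. Qed.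

(** * Rolle's theorem and the number of zeros *)

Fixpoint chain (x : R) (zs : list R) (y : R) : Prop :=
  match zs with
  | nil => x < y
  | z :: l => x < z /\ chain z l y
  end.

Lemma chain_weaken (x x' y : R) (zs : list R) :
  x <= x' -> chain x' zs y -> chain x zs y.
Proof. destruct zs as [|z l]; simpl; intros; [lra|]. split; [lra|tauto]. Qed.

Lemma chain_lt (zs : list R) (x y : R) : chain x zs y -> x < y.
Proof.
  revert x. induction zs as [|z l IH]; simpl; intros x H; [exact H|].
  destruct H as [H1 H2]. apply IH in H2. lra.
Qed.

Lemma chain_inside (zs : list R) (x y : R) :
  chain x zs y -> Forall (fun z => x < z < y) zs.
Proof.
  revert x. induction zs as [|z l IH]; simpl; intros x H; constructor.
  - destruct H as [H1 H2]. apply chain_lt in H2. lra.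
  - destruct H as [H1 H2]. apply IH in H2.
    eapply Forall_impl; [|exact H2]. simpl. intros; lra.
Qed.

Lemma chain_exists (N : nat) (x y : R) :
  x < y -> exists zs, length zs = N /\ chain x zs y.
Proof.
  revert x. induction N as [|N IH]; intros x H.
  - exists nil. simpl. auto.
  - destruct (IH ((x + y) / 2)) as [zs [H1 H2]]; [lra|].
    exists ((x + y) / 2 :: zs). simpl. repeat split; [lia|lra|exact H2].
Qed.

Lemma rolle_chain_left (f f' : R -> R) (zs : list R) (x y : R) :
  (forall v, derivable_pt_lim f v (f' v)) -> chain x zs y ->
  f x = 0 -> Forall (fun z => f z = 0) zs ->
  exists ws, chain x ws y /\ Forall (fun z => f' z = 0) ws /\ length ws = length zs.
Proof.
  intros Hd. revert x. induction zs as [|z l IH]; simpl; intros x Hc Hx Hz.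
  - exists nil. simpl. auto.
  - destruct Hc as [H1 H2]. inversion Hz; subst.
    destruct (IH z H2) as [ws [Hw1 [Hw2 Hw3]]]; try assumption.
    destruct (MVT_cor2 f f' x z H1) as [w [Hw Hwi]]; [intros; apply Hd|].
    exists (w :: ws). simpl. repeat split; try lra.
    + apply chain_weaken with z; [lra|exact Hw1].
    + constructor; [nra|exact Hw2].
    + lia.
Qed.

Lemma rolle_chain_both (f f' : R -> R) (zs : list R) (x y : R) :
  (forall v, derivable_pt_lim f v (f' v)) -> chain x zs y ->
  f x = 0 -> f y = 0 -> Forall (fun z => f z = 0) zs ->
  exists ws, chain x ws y /\ Forall (fun z => f' z = 0) ws /\ length ws = S (length zs).
Proof.
  intros Hd. revert x. induction zs as [|z l IH]; simpl; intros x Hc Hx Hy Hz.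
  - destruct (MVT_cor2 f f' x y Hc) as [w [Hw Hwi]]; [intros; apply Hd|].
    exists (w :: nil). simpl. repeat split; try lra.
    constructor; [nra|constructor].
  - destruct Hc as [H1 H2]. inversion Hz; subst.
    destruct (IH z H2) as [ws [Hw1 [Hw2 Hw3]]]; try assumption.
    destruct (MVT_cor2 f f' x z H1) as [w [Hw Hwi]]; [intros; apply Hd|].
    exists (w :: ws). simpl. repeat split; try lra.
    + apply chain_weaken with z; [lra|exact Hw1].
    + constructor; [nra|exact Hw2].
    + lia.
Qed.

(** A zero of order k > 0 at an end serves Rolle's theorem as one point and leaves order k - 1 to
    the derivative. New zeros lie between consecutive old ones, so the total count drops by at most
    one. *)
Lemma rolle_chain (f f' : R -> R) (zs : list R) (x y : R) (k l : nat) :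
  (forall v, derivable_pt_lim f v (f' v)) -> chain x zs y ->
  ((0 < k)%nat -> f x = 0) -> ((0 < l)%nat -> f y = 0) -> Forall (fun z => f z = 0) zs ->
  exists ws, chain x ws y /\ Forall (fun z => f' z = 0) ws /\
    (k + l + length zs <= S (pred k + pred l + length ws))%nat.
Proof.
  intros Hd Hc Hx Hy Hz. destruct k as [|k]; [destruct zs as [|z zs]|].
  - exists nil. simpl in *. repeat split; try assumption; [constructor|lia].
  - destruct Hc as [H1 H2]. inversion Hz; subst. destruct l as [|l].
    + destruct (rolle_chain_left f f' zs z y) as [ws [Hw1 [Hw2 Hw3]]]; try assumption.
      exists ws. repeat split; [|exact Hw2|simpl; lia].
      apply chain_weaken with z; [lra|exact Hw1].
    + destruct (rolle_chain_both f f' zs z y) as [ws [Hw1 [Hw2 Hw3]]]; try assumption.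
      { apply Hy; lia. }
      exists ws. repeat split; [|exact Hw2|simpl; lia].
      apply chain_weaken with z; [lra|exact Hw1].
  - destruct l as [|l].
    + destruct (rolle_chain_left f f' zs x y) as [ws [Hw1 [Hw2 Hw3]]]; try assumption.
      { apply Hx; lia. }
      exists ws. repeat split; [exact Hw1|exact Hw2|simpl; lia].
    + destruct (rolle_chain_both f f' zs x y) as [ws [Hw1 [Hw2 Hw3]]]; try assumption.
      { apply Hx; lia. } { apply Hy; lia. }
      exists ws. repeat split; [exact Hw1|exact Hw2|simpl; lia].
Qed.

(** The factor e^{-r_0 v} has no zeros and turns d/dv into d/dv - r_0, so that Rolle's theorem
    speaks about [drop_low]. *)
Lemma derivable_pt_lim_low (r : nat -> R) (m : nat) (c : nat -> R) (v : R) :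
  derivable_pt_lim (fun x => exp (- r O * x) * mom r (S m) c 0 x) v
    (exp (- r O * v) * mom (fun j => r (S j)) m (drop_low r c) 0 v).
Proof.
  rewrite mom_drop_low.
  replace (exp (- r O * v) * (mom r (S m) c 1 v - r O * mom r (S m) c 0 v))
    with ((exp (- r O * v) * (- r O * 1)) * mom r (S m) c 0 v
          + exp (- r O * v) * mom r (S m) c 1 v) by ring.
  apply (derivable_pt_lim_mult (fun x => exp (- r O * x)) (mom r (S m) c 0)).
  - apply (derivable_pt_lim_comp (fun x => - r O * x) exp).
    + apply (derivable_pt_lim_scal (fun x => x)). apply derivable_pt_lim_id.
    + apply derivable_pt_lim_exp.
  - apply derivable_pt_lim_mom.
Qed.

Lemma Forall_impl_eq (f g : R -> R) (zs : list R) :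
  (forall z, f z = 0 -> g z = 0) ->
  Forall (fun z => f z = 0) zs -> Forall (fun z => g z = 0) zs.
Proof. intros H. apply Forall_impl. exact H. Qed.

(** The kernel of d/dv - r_0 is spanned by e^{r_0 v}, and a single zero excludes its nonzero
    multiples. *)
Lemma drop_low_zero (r : nat -> R) (m : nat) (c : nat -> R) (z : R) :
  strictly_incr r -> (forall j, (j <= m)%nat -> drop_low r c j = 0) ->
  mom r (S m) c 0 z = 0 -> forall j, (j <= S m)%nat -> c j = 0.
Proof.
  intros Hr HD Hz.
  assert (H1 : forall j, (j <= m)%nat -> c (S j) = 0).
  { intros j Hj. specialize (HD j Hj). unfold drop_low in HD.
    pose proof (strictly_incr_lt r 0 (S j) Hr ltac:(lia)).
    apply Rmult_integral in HD. destruct HD as [HD|HD]; [lra|exact HD]. }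
  intros [|j] Hj; [|apply H1; lia].
  unfold mom in Hz. rewrite sum_split_first, sum_eq_R0 in Hz.
  - pose proof (exp_pos (r O * z)). simpl in Hz. nra.
  - intros j' Hj'. rewrite H1 by exact Hj'. ring.
Qed.

Lemma vanishing_point (r : nat -> R) (m : nat) (c : nat -> R) (al be : R)
    (k l : nat) (zs : list R) :
  vanish r m c k al -> vanish r m c l be -> Forall (fun z => mom r m c 0 z = 0) zs ->
  (0 < k + l + length zs)%nat -> exists z, mom r m c 0 z = 0.
Proof.
  intros Hk Hl Hz Hlen. destruct k as [|k]; [destruct l as [|l]; [destruct zs as [|z zs]|]|].
  - simpl in Hlen. lia.
  - exists z. inversion Hz. assumption.
  - exists be. apply Hl. lia.
  - exists al. apply Hk. lia.
Qed.

(** The extended Chebyshev property, by induction on m: [drop_low] removes one exponent and at most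
    one zero. Orders are counted at the two ends only, where the basis functions have their multiple
    zeros. *)
Lemma zero_bound (m : nat) : forall (r : nat -> R) (c : nat -> R) (al be : R)
    (k l : nat) (zs : list R),
  strictly_incr r -> chain al zs be ->
  vanish r m c k al -> vanish r m c l be -> Forall (fun z => mom r m c 0 z = 0) zs ->
  (m < k + l + length zs)%nat -> forall j, (j <= m)%nat -> c j = 0.
Proof.
  induction m as [|m IH]; intros r c al be k l zs Hr Hc Hk Hl Hz Hlen;
    destruct (vanishing_point _ _ _ _ _ k l zs Hk Hl Hz ltac:(lia)) as [z0 Hz0].
  - intros j Hj. replace j with O by lia. unfold mom in Hz0. simpl in Hz0.
    pose proof (exp_pos (r O * z0)). nra.
  - apply (drop_low_zero r m c z0 Hr); [|exact Hz0].
    destruct (rolle_chain _ _ zs al be k l (derivable_pt_lim_low r m c) Hc)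
      as [ws [Hw1 [Hw2 Hw3]]].
    + intros H. rewrite Hk by lia. ring.
    + intros H. rewrite Hl by lia. ring.
    + revert Hz. apply Forall_impl_eq. intros z Hzz. rewrite Hzz. ring.
    + apply (IH (fun j => r (S j)) _ al be (pred k) (pred l) ws).
      * apply strictly_incr_shift; exact Hr.
      * exact Hw1.
      * destruct k; [intros p Hp; simpl in Hp; lia|apply vanish_drop_low; exact Hk].
      * destruct l; [intros p Hp; simpl in Hp; lia|apply vanish_drop_low; exact Hl].
      * revert Hw2. apply Forall_impl_eq. intros z Hzz.
        pose proof (exp_pos (- r O * z)). nra.
      * lia.
Qed.

Lemma zero_on_interval (r : nat -> R) (m : nat) (c : nat -> R) (al be : R) :
  strictly_incr r -> al < be -> (forall v, al < v < be -> mom r m c 0 v = 0) ->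
  forall j, (j <= m)%nat -> c j = 0.
Proof.
  intros Hr Hab H. destruct (chain_exists (S m) al be Hab) as [zs [Hlen Hc]].
  apply (zero_bound m r c al be 0 0 zs Hr Hc); try (intros p Hp; lia); [|lia].
  eapply Forall_impl; [|apply (chain_inside _ _ _ Hc)]. exact H.
Qed.

(** Gaussian elimination of the last unknown with a pivot row; if its column is zero, the last unit
    vector is a solution. *)
Lemma kernel_exists (N : nat) : forall a : nat -> nat -> R,
  exists c, (exists j, (j <= N)%nat /\ c j <> 0) /\
    forall i, (i < N)%nat -> sum_f_R0 (fun j => a i j * c j) N = 0.
Proof.
  induction N as [|N IH]; intros a.
  - exists (fun _ => 1). split; [exists O; split; [lia|lra]|lia].
  - destruct (classic (exists i, (i < S N)%nat /\ a i (S N) <> 0)) as [[i0 [Hi0 Ha]]|Hno].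
    (* [sg] enumerates the rows other than the pivot row [i0]. *)
    + set (sg := fun i => if Nat.ltb i i0 then i else S i).
      destruct (IH (fun i j => a (sg i) j - a (sg i) (S N) / a i0 (S N) * a i0 j))
        as [c [[j0 [Hj0 Hc0]] Hc]].
      set (x := - sum_f_R0 (fun j => a i0 j * c j) N / a i0 (S N)).
      exists (fun j => if Nat.eq_dec j (S N) then x else c j).
      assert (Hs : forall i, sum_f_R0 (fun j => a i j * (if Nat.eq_dec j (S N) then x else c j)) (S N)
                   = sum_f_R0 (fun j => a i j * c j) N + a i (S N) * x).
      { intros i. rewrite tech5. destruct (Nat.eq_dec (S N) (S N)); [|lia]. f_equal.
        apply sum_eq. intros j Hj. destruct (Nat.eq_dec j (S N)); [lia|reflexivity]. }
      split.
      * exists j0. split; [lia|]. destruct (Nat.eq_dec j0 (S N)); [lia|exact Hc0].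
      * intros i Hi. rewrite Hs. destruct (Nat.eq_dec i i0) as [->|Hne].
        { unfold x. field. exact Ha. }
        assert (Hi' : exists i', (i' < N)%nat /\ sg i' = i).
        { unfold sg. destruct (Nat.lt_ge_cases i i0).
          - exists i. split; [lia|]. destruct (Nat.ltb_spec i i0); lia.
          - exists (pred i). split; [lia|]. destruct (Nat.ltb_spec (pred i) i0); lia. }
        destruct Hi' as [i' [Hi' <-]]. specialize (Hc i' Hi').
        rewrite (sum_eq _ (fun j => a (sg i') j * c j
                   - a (sg i') (S N) / a i0 (S N) * (a i0 j * c j))) in Hc
          by (intros; ring).
        rewrite minus_sum, sum_scal_l in Hc. rewrite <- Hc. unfold x. field. exact Ha.
    + exists (unit_vec (S N)). split.
      * exists (S N). split; [lia|]. unfold unit_vec.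
        destruct (Nat.eq_dec (S N) (S N)); [lra|lia].
      * intros i Hi. rewrite (sum_eq _ (fun j => unit_vec (S N) j * a i j))
          by (intros; ring).
        rewrite sum_unit_vec by lia. apply NNPP. intros H. apply Hno. exists i. auto.
Qed.

(** * Chebyshev-Bernstein bases *)

(** These are k + (m - k) = m linear conditions on m + 1 coefficients. *)
Lemma basis_element_exists (r : nat -> R) (m : nat) (al be : R) (k : nat) :
  (k <= m)%nat -> exists c, vanish r m c k al /\ vanish r m c (m - k) be /\
    exists j, (j <= m)%nat /\ c j <> 0.
Proof.
  intros Hk.
  destruct (kernel_exists m (fun i j => if Nat.ltb i k then r j ^ i * exp (r j * al)
              else r j ^ (i - k) * exp (r j * be))) as [c [Hc H]].
  exists c. split; [|split; [|exact Hc]].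
  - intros p Hp. specialize (H p ltac:(lia)). rewrite <- H. apply sum_eq. intros j _.
    destruct (Nat.ltb_spec p k); [ring|lia].
  - intros p Hp. specialize (H (p + k)%nat ltac:(lia)). rewrite <- H. apply sum_eq.
    intros j _. destruct (Nat.ltb_spec (p + k) k); [lia|].
    replace (p + k - k)%nat with p by lia. ring.
Qed.

(** [M p i] stands for the p-th derivative of the i-th function at an end of the interval and [o i]
    for its exact order there. Distinct orders make the system triangular, and it is solved by
    increasing order. It serves at [al] with o i = i and at [be] with o i = m - i. *)
Lemma triangular (m K : nat) (M : nat -> nat -> R) (o : nat -> nat) (lam : nat -> R) :
  (forall i p, (i <= m)%nat -> (p < o i)%nat -> M p i = 0) ->
  (forall i, (i <= m)%nat -> M (o i) i <> 0) ->
  (forall i i', (i <= m)%nat -> (i' <= m)%nat -> o i = o i' -> i = i') ->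
  (forall p, (p < K)%nat -> sum_f_R0 (fun i => lam i * M p i) m = 0) ->
  forall i, (i <= m)%nat -> (o i < K)%nat -> lam i = 0.
Proof.
  intros Hz Hnz Hinj Hs.
  assert (H : forall n i, (i <= m)%nat -> (o i < n)%nat -> (n <= K)%nat -> lam i = 0).
  { induction n as [|n IH]; intros i Hi Hn HnK; [lia|].
    destruct (Nat.lt_ge_cases (o i) n) as [Hlt|Hge]; [apply IH; lia|].
    specialize (Hs (o i) ltac:(lia)). rewrite (sum_single _ m i Hi) in Hs.
    - apply Rmult_integral in Hs. destruct Hs as [Hs|Hs]; [exact Hs|].
      exfalso. exact (Hnz i Hi Hs).
    - intros i' Hi' Hne. destruct (Nat.lt_ge_cases (o i') n).
      + rewrite IH by lia. ring.
      + rewrite (Hz i' (o i)); [ring|exact Hi'|].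
        assert (o i' <> o i) by (intros E; apply Hne; apply Hinj; auto). lia. }
  intros i Hi HK. apply (H K); lia.
Qed.

(** The prescribed orders already use up the m zeros that [zero_bound] allows. The next two lemmas
    exclude one more zero at the other end and inside. *)
Lemma lead_left_neq (r : nat -> R) (m : nat) (al be : R) (k : nat) (c : nat -> R) :
  strictly_incr r -> al < be -> (k <= m)%nat ->
  vanish r m c k al -> vanish r m c (m - k) be -> (exists j, (j <= m)%nat /\ c j <> 0) ->
  mom r m c k al <> 0.
Proof.
  intros Hr Hab Hk Hal Hbe [j [Hj Hcj]] H0. apply Hcj.
  apply (zero_bound m r c al be (S k) (m - k) nil); simpl; auto; try lia.
  intros p Hp. destruct (Nat.eq_dec p k) as [->|]; [exact H0|apply Hal; lia].
Qed.

Lemma lead_right_neq (r : nat -> R) (m : nat) (al be : R) (k : nat) (c : nat -> R) :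
  strictly_incr r -> al < be -> (k <= m)%nat ->
  vanish r m c k al -> vanish r m c (m - k) be -> (exists j, (j <= m)%nat /\ c j <> 0) ->
  mom r m c (m - k) be <> 0.
Proof.
  intros Hr Hab Hk Hal Hbe [j [Hj Hcj]] H0. apply Hcj.
  apply (zero_bound m r c al be k (S (m - k)) nil); simpl; auto; try lia.
  intros p Hp. destruct (Nat.eq_dec p (m - k)) as [->|]; [exact H0|apply Hbe; lia].
Qed.

Lemma interior_neq (r : nat -> R) (m : nat) (al be : R) (k : nat) (c : nat -> R) :
  strictly_incr r -> al < be -> (k <= m)%nat ->
  vanish r m c k al -> vanish r m c (m - k) be -> (exists j, (j <= m)%nat /\ c j <> 0) ->
  forall v, al < v < be -> mom r m c 0 v <> 0.
Proof.
  intros Hr Hab Hk Hal Hbe [j [Hj Hcj]] v Hv H0. apply Hcj.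
  apply (zero_bound m r c al be k (m - k) (v :: nil)); simpl; auto; try lia; try lra.
Qed.

Lemma constant_sign (f : R -> R) (al be w : R) :
  continuity f -> (forall v, al < v < be -> f v <> 0) -> al < w < be -> 0 < f w ->
  forall v, al < v < be -> 0 < f v.
Proof.
  intros Hf Hn Hw Hfw v Hv.
  destruct (Rlt_le_dec 0 (f v)) as [H|H]; [exact H|exfalso].
  destruct (Rle_lt_dec v w) as [Hvw|Hvw].
  - destruct (IVT_cor f v w Hf Hvw) as [z [Hz1 Hz2]]; [nra|].
    apply (Hn z); [lra|exact Hz2].
  - destruct (IVT_cor f w v Hf) as [z [Hz1 Hz2]]; [lra|nra|].
    apply (Hn z); [lra|exact Hz2].
Qed.

(** By continuity the k-th derivative is negative near [al]; the mean value theorem passes the sign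
    down to the lower derivatives, which all vanish at [al]. *)
Lemma negative_right_of_zero (r : nat -> R) (m : nat) (c : nat -> R) (k : nat) (al : R) :
  vanish r m c k al -> mom r m c k al < 0 ->
  exists d, 0 < d /\ forall v, al < v < al + d -> mom r m c 0 v < 0.
Proof.
  intros Hv Hneg.
  destruct (continuity_mom r m c k al (- mom r m c k al)) as [d [Hd Hcont]]; [lra|].
  exists d. split; [exact Hd|].
  assert (H : forall i, (i <= k)%nat -> forall v, al < v < al + d -> mom r m c (k - i) v < 0).
  { induction i as [|i IH]; intros Hi v Hvd.
    - rewrite Nat.sub_0_r. specialize (Hcont v). simpl in Hcont. unfold Rdist in Hcont.
      assert (Rabs (mom r m c k v - mom r m c k al) < - mom r m c k al) as Habs.
      { apply Hcont. split; [split; [exact I|lra]|].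
        rewrite Rabs_right; lra. }
      apply Rabs_def2 in Habs. lra.
    - destruct (MVT_cor2 (mom r m c (k - S i)) (mom r m c (S (k - S i))) al v)
        as [w [Hw1 Hw2]]; [lra|intros; apply derivable_pt_lim_mom|].
      rewrite (Hv (k - S i)%nat) in Hw1 by lia.
      replace (S (k - S i)) with (k - i)%nat in Hw1 by lia.
      assert (mom r m c (k - i) w < 0) by (apply IH; lra || lia). nra. }
  intros v Hvd. replace O with (k - k)%nat by lia. apply H; auto.
Qed.

Lemma lead_pos (r : nat -> R) (m : nat) (c : nat -> R) (k : nat) (al be : R) :
  al < be -> vanish r m c k al -> (forall v, al < v < be -> 0 < mom r m c 0 v) ->
  mom r m c k al <> 0 -> 0 < mom r m c k al.
Proof.
  intros Hab Hv Hpos Hne. apply NNPP. intros Hn.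
  destruct (negative_right_of_zero r m c k al Hv) as [d [Hd H]]; [lra|].
  set (v := al + Rmin d (be - al) / 2).
  assert (0 < Rmin d (be - al)) by (apply Rmin_glb_lt; lra).
  pose proof (Rmin_l d (be - al)). pose proof (Rmin_r d (be - al)).
  assert (al < v < al + d) by (unfold v; lra).
  assert (al < v < be) by (unfold v; lra).
  specialize (H v ltac:(assumption)). specialize (Hpos v ltac:(assumption)). lra.
Qed.

Definition left_family (r : nat -> R) (m : nat) (al : R) (b : nat -> nat -> R) : Prop :=
  forall k, (k <= m)%nat -> vanish r m (b k) k al /\ mom r m (b k) k al <> 0.

(** The derivatives at [al] are matched one order at a time, [b K] being free to correct order K
    without disturbing lower ones. The difference then has m + 1 zeros at [al]. *)
Lemma expand (r : nat -> R) (m : nat) (al be : R) (b : nat -> nat -> R) (c : nat -> R) :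
  strictly_incr r -> al < be -> left_family r m al b ->
  exists lam, forall j, (j <= m)%nat -> c j = comb lam b m j.
Proof.
  intros Hr Hab Hb.
  assert (H : forall K, (K <= S m)%nat -> exists lam, forall p, (p < K)%nat ->
            mom r m c p al = sum_f_R0 (fun k => lam k * mom r m (b k) p al) m).
  { induction K as [|K IH]; intros HK.
    - exists (fun _ => 0). lia.
    - destruct (IH ltac:(lia)) as [lam Hlam].
      destruct (Hb K ltac:(lia)) as [HbK HbK0].
      set (x := (mom r m c K al - sum_f_R0 (fun k => lam k * mom r m (b k) K al) m)
                / mom r m (b K) K al).
      exists (fun k => lam k + unit_vec K k * x). intros p Hp.
      rewrite (sum_eq _ (fun k => lam k * mom r m (b k) p al
                 + unit_vec K k * (x * mom r m (b k) p al))) by (intros; ring).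
      rewrite plus_sum, (sum_unit_vec (fun k => x * mom r m (b k) p al)) by lia.
      destruct (Nat.eq_dec p K) as [->|].
      + unfold x. field. exact HbK0.
      + rewrite HbK by lia. rewrite Hlam by lia. ring. }
  destruct (H (S m) ltac:(lia)) as [lam Hlam]. exists lam. intros j Hj.
  apply Rminus_diag_uniq.
  apply (zero_bound m r (fun j => c j - comb lam b m j) al be (S m) 0 nil);
    simpl; auto; try lia; [|intros p Hp; lia].
  intros p Hp.
  rewrite (mom_ext r m _ (fun j => c j + (-1) * comb lam b m j)) by (intros; ring).
  rewrite mom_plus, mom_scal, mom_comb, (Hlam p Hp). ring.
Qed.

Lemma comb_vanish_left (r : nat -> R) (m : nat) (al : R) (b : nat -> nat -> R)
    (lam : nat -> R) (K : nat) :
  left_family r m al b -> vanish r m (comb lam b m) K al ->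
  forall i, (i <= m)%nat -> (i < K)%nat -> lam i = 0.
Proof.
  intros Hb Hv.
  apply (triangular m K (fun p i => mom r m (b i) p al) (fun i => i) lam).
  - intros i p Hi Hp. apply Hb; assumption.
  - intros i Hi. apply Hb; assumption.
  - auto.
  - intros p Hp. rewrite <- mom_comb. apply Hv; exact Hp.
Qed.

Lemma comb_unique (r : nat -> R) (m : nat) (al : R) (b : nat -> nat -> R)
    (lam mu : nat -> R) :
  left_family r m al b -> (forall j, (j <= m)%nat -> comb lam b m j = comb mu b m j) ->
  forall i, (i <= m)%nat -> lam i = mu i.
Proof.
  intros Hb H i Hi. apply Rminus_diag_uniq.
  apply (comb_vanish_left r m al b (fun i => lam i - mu i) (S m) Hb); [|exact Hi|lia].
  intros p Hp. apply mom_zero. intros j Hj. unfold comb in *.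
  rewrite (sum_eq _ (fun k => lam k * b k j - mu k * b k j)) by (intros; ring).
  rewrite minus_sum, (H j Hj). ring.
Qed.

(* al = ln a and be = ln b; that the orders are exact and the B_k positive on (al, be) follows. *)
Definition cb_basis (r : nat -> R) (m : nat) (al be : R) (B : nat -> nat -> R) : Prop :=
  (forall k, (k <= m)%nat -> vanish r m (B k) k al /\ vanish r m (B k) (m - k) be) /\
  (forall j, (j <= m)%nat -> comb (fun _ => 1) B m j = unit_vec O j).

(** Up to positive factors, the images of these tails under [drop_low] form the basis for the
    exponents r_1, r_2, ... *)
Definition upper_sum (B : nat -> nat -> R) (m k : nat) : nat -> R :=
  comb (fun i => if Nat.leb k i then 1 else 0) B m.

Lemma cb_basis_sum (r : nat -> R) (m : nat) (al be : R) (B : nat -> nat -> R) (p : nat) (v : R) :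
  cb_basis r m al be B ->
  sum_f_R0 (fun k => mom r m (B k) p v) m = r O ^ p * exp (r O * v).
Proof.
  intros [_ H]. rewrite <- (mom_unit_vec r m) by lia.
  rewrite <- (mom_ext r m _ _ p v H), mom_comb. apply sum_eq. intros; ring.
Qed.

Lemma cb_basis_left_end (r : nat -> R) (m : nat) (al be : R) (B : nat -> nat -> R) :
  cb_basis r m al be B -> mom r m (B O) 0 al = exp (r O * al).
Proof.
  intros HB. pose proof (cb_basis_sum r m al be B 0 al HB) as H.
  rewrite (sum_single _ m 0) in H; [rewrite H; ring|lia|].
  intros i Hi Hi0. apply HB; lia.
Qed.

Lemma cb_basis_right_end (r : nat -> R) (m : nat) (al be : R) (B : nat -> nat -> R) :
  cb_basis r m al be B -> mom r m (B m) 0 be = exp (r O * be).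
Proof.
  intros HB. pose proof (cb_basis_sum r m al be B 0 be HB) as H.
  rewrite (sum_single _ m m) in H; [rewrite H; ring|lia|].
  intros i Hi Him. apply HB; lia.
Qed.

(** The tail F vanishes to order k + 1 at [al]; its complement G in e^{r_0 v} vanishes to order m -
    k + 1 at [be]. Since [drop_low] kills e^{r_0 v}, it maps F and -G to the same element, which has
    all its m zeros at the ends and hence a constant sign inside. The sign is positive because
    e^{-r_0 v} F rises from 0 to 1. So F > 0 inside, and its leading derivative at [al] is that of
    B_{k+1}. *)
Lemma upper_sum_facts (r : nat -> R) (m : nat) (al be : R) (B : nat -> nat -> R) (k : nat) :
  strictly_incr r -> al < be -> cb_basis r (S m) al be B -> (k <= m)%nat ->
  let F := upper_sum B (S m) (S k) in
  let r' := fun j => r (S j) in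
  vanish r' m (drop_low r F) k al /\ vanish r' m (drop_low r F) (m - k) be /\
  (forall v, al < v < be -> 0 < mom r' m (drop_low r F) 0 v) /\
  0 < mom r (S m) (B (S k)) (S k) al.
Proof.
  intros Hr Hab HB Hk F r'.
  pose proof HB as [HBv HBs].
  set (G := comb (fun i => if Nat.leb (S k) i then 0 else 1) B (S m)).
  assert (HFG : forall j, (j <= S m)%nat -> F j + G j = unit_vec O j).
  { intros j Hj. rewrite <- HBs by exact Hj. unfold F, G, upper_sum, comb.
    rewrite <- plus_sum. apply sum_eq. intros i _. destruct (Nat.leb (S k) i); ring. }
  assert (HF : vanish r (S m) F (S k) al).
  { apply vanish_comb. intros i Hi Hi0. destruct (Nat.leb_spec (S k) i); [|lra].
    apply vanish_le with i; [lia|]. apply HBv; exact Hi. }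
  assert (HG : vanish r (S m) G (S (m - k)) be).
  { apply vanish_comb. intros i Hi Hi0. destruct (Nat.leb_spec (S k) i); [lra|].
    apply vanish_le with (S m - i)%nat; [lia|]. apply HBv; exact Hi. }
  assert (HDal : vanish r' m (drop_low r F) k al) by (apply vanish_drop_low; exact HF).
  assert (HDbe : vanish r' m (drop_low r F) (m - k) be).
  { apply vanish_drop_low in HG.
    apply vanish_ext with (fun j => (-1) * drop_low r G j).
    - intros j Hj. specialize (HFG (S j) ltac:(lia)). unfold unit_vec in HFG.
      simpl in HFG. unfold drop_low. replace (F (S j)) with (- G (S j)) by lra. ring.
    - intros p Hp. rewrite mom_scal, HG by exact Hp. ring. }
  assert (HFbe : mom r (S m) F 0 be = exp (r O * be)).
  { rewrite (mom_ext r (S m) F (fun j => unit_vec O j + (-1) * G j))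
      by (intros j Hj; rewrite <- (HFG j Hj); ring).
    rewrite mom_plus, mom_scal, (HG O) by lia. rewrite mom_unit_vec by lia. ring. }
  assert (HFal : mom r (S m) F 0 al = 0) by (apply HF; lia).
  assert (Hnz : exists j, (j <= m)%nat /\ drop_low r F j <> 0).
  { apply NNPP. intros Hn.
    assert (H0 : forall j, (j <= S m)%nat -> F j = 0).
    { apply (drop_low_zero r m F al Hr); [|exact HFal].
      intros j Hj. apply NNPP. intros Hj0. apply Hn. exists j. auto. }
    rewrite (mom_zero r (S m) F 0 be H0) in HFbe.
    pose proof (exp_pos (r O * be)). lra. }
  pose proof (strictly_incr_shift r Hr) as Hr'.
  assert (Hgd : forall x y, x < y -> exists w,
             exp (- r O * y) * mom r (S m) F 0 y - exp (- r O * x) * mom r (S m) F 0 x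
             = exp (- r O * w) * mom r' m (drop_low r F) 0 w * (y - x) /\ x < w < y).
  { intros x y Hxy.
    apply (MVT_cor2 (fun x => exp (- r O * x) * mom r (S m) F 0 x)
             (fun x => exp (- r O * x) * mom r' m (drop_low r F) 0 x) x y Hxy).
    intros z _. apply derivable_pt_lim_low. }
  assert (Hpos : forall v, al < v < be -> 0 < mom r' m (drop_low r F) 0 v).
  { destruct (Hgd al be Hab) as [w [Hw1 Hw2]].
    apply constant_sign with w; [apply continuity_mom| |exact Hw2|].
    - apply interior_neq with k; auto.
    - rewrite HFal, HFbe in Hw1.
      pose proof (exp_pos (- r O * w)). pose proof (exp_pos (- r O * be)).
      pose proof (exp_pos (r O * be)).
      assert (0 < exp (- r O * be) * exp (r O * be)) by (apply Rmult_lt_0_compat; assumption).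
      apply NNPP. intros Hn.
      assert (exp (- r O * w) * mom r' m (drop_low r F) 0 w <= 0) by nra. nra. }
  assert (HFpos : forall v, al < v < be -> 0 < mom r (S m) F 0 v).
  { intros v Hv. destruct (Hgd al v) as [w [Hw1 Hw2]]; [lra|].
    rewrite HFal in Hw1. specialize (Hpos w ltac:(lra)).
    pose proof (exp_pos (- r O * w)). pose proof (exp_pos (- r O * v)).
    assert (0 < exp (- r O * w) * mom r' m (drop_low r F) 0 w * (v - al)).
    { apply Rmult_lt_0_compat; [apply Rmult_lt_0_compat; assumption|lra]. }
    apply NNPP. intros Hn. nra. }
  split; [exact HDal|split; [exact HDbe|split; [exact Hpos|]]].
  (* The other terms of F vanish at [al] to order at least k + 2. *)
  replace (mom r (S m) (B (S k)) (S k) al) with (mom r (S m) F (S k) al).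
  - apply lead_pos with be; auto. intros H0.
    apply (lead_left_neq r' m al be k (drop_low r F)); auto.
    unfold r'. rewrite mom_drop_low, H0, (HF k) by lia. ring.
  - unfold F, upper_sum. rewrite mom_comb, (sum_single _ (S m) (S k)); [|lia|].
    + destruct (Nat.leb_spec (S k) (S k)); [ring|lia].
    + intros i Hi Hne. destruct (Nat.leb_spec (S k) i); [|ring].
      rewrite (proj1 (HBv i Hi)) by lia. ring.
Qed.

Lemma cb_basis_lead (r : nat -> R) (m : nat) (al be : R) (B : nat -> nat -> R) (k : nat) :
  strictly_incr r -> al < be -> cb_basis r m al be B -> (k <= m)%nat ->
  0 < mom r m (B k) k al.
Proof.
  intros Hr Hab HB Hk. destruct k as [|k].
  - rewrite (cb_basis_left_end r m al be B HB). apply exp_pos.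
  - destruct m as [|m]; [lia|].
    destruct (upper_sum_facts r m al be B k) as [_ [_ [_ H]]]; auto. lia.
Qed.

Lemma cb_basis_left_family (r : nat -> R) (m : nat) (al be : R) (B : nat -> nat -> R) :
  strictly_incr r -> al < be -> cb_basis r m al be B -> left_family r m al B.
Proof.
  intros Hr Hab HB k Hk. split; [apply HB; exact Hk|].
  pose proof (cb_basis_lead r m al be B k Hr Hab HB Hk). lra.
Qed.

Lemma lead_nonzero (r : nat -> R) (m : nat) (c : nat -> R) (p : nat) (v : R) :
  mom r m c p v <> 0 -> exists j, (j <= m)%nat /\ c j <> 0.
Proof.
  intros H. apply NNPP. intros Hn. apply H. apply mom_zero. intros j Hj.
  apply NNPP. intros Hj0. apply Hn. exists j. auto.
Qed.

Lemma cb_basis_pos (r : nat -> R) (m : nat) (al be : R) (B : nat -> nat -> R) (k : nat) (v : R) :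
  strictly_incr r -> al < be -> cb_basis r m al be B -> (k <= m)%nat -> al < v < be ->
  0 < mom r m (B k) 0 v.
Proof.
  intros Hr Hab HB Hk Hv.
  pose proof (cb_basis_lead r m al be B k Hr Hab HB Hk) as Hl.
  destruct (proj1 HB k Hk) as [Hal Hbe].
  assert (Hn : forall w, al < w < be -> mom r m (B k) 0 w <> 0).
  { apply interior_neq with k; auto. apply (lead_nonzero r m (B k) k al). lra. }
  destruct (Rlt_le_dec 0 (mom r m (B k) 0 v)) as [H|H]; [exact H|exfalso].
  assert (Hneg : 0 < mom r m (fun j => (-1) * B k j) k al).
  { apply lead_pos with be; auto.
    - intros p Hp. rewrite mom_scal, Hal by exact Hp. ring.
    - apply constant_sign with v; [apply continuity_mom| |exact Hv|].
      + intros w Hw. rewrite mom_scal. specialize (Hn w Hw). lra.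
      + rewrite mom_scal. specialize (Hn v Hv). lra.
    - rewrite mom_scal. lra. }
  rewrite mom_scal in Hneg. lra.
Qed.

Lemma cb_basis_nonneg (r : nat -> R) (m : nat) (al be : R) (B : nat -> nat -> R) (k : nat) (v : R) :
  strictly_incr r -> al < be -> cb_basis r m al be B -> (k <= m)%nat -> al <= v <= be ->
  0 <= mom r m (B k) 0 v.
Proof.
  intros Hr Hab HB Hk Hv.
  destruct (Req_dec v al) as [->|Hva]; [|destruct (Req_dec v be) as [->|Hvb]].
  - destruct k as [|k].
    + rewrite (cb_basis_left_end r m al be B HB). left. apply exp_pos.
    + right. symmetry. apply HB; [exact Hk|lia].
  - destruct (Nat.eq_dec k m) as [->|].
    + rewrite (cb_basis_right_end r m al be B HB). left. apply exp_pos.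
    + right. symmetry. apply (proj1 HB k Hk). lia.
  - left. apply cb_basis_pos with al be; auto. lra.
Qed.

Lemma cb_basis_exists (r : nat -> R) (m : nat) (al be : R) :
  strictly_incr r -> al < be -> exists B, cb_basis r m al be B.
Proof.
  intros Hr Hab.
  set (P := fun k c => (k <= m)%nat -> vanish r m c k al /\ vanish r m c (m - k) be /\
              exists j, (j <= m)%nat /\ c j <> 0).
  assert (He : forall k, exists c, P k c).
  { intros k. destruct (Nat.le_gt_cases k m) as [H|H].
    - destruct (basis_element_exists r m al be k H) as [c Hc]. exists c. intros _. exact Hc.
    - exists (fun _ => 0). intros Hk. lia. }
  destruct (seq_choice _ P He) as [b Hb].
  assert (Hfam : left_family r m al b).
  { intros k Hk. destruct (Hb k Hk) as [H1 [H2 H3]].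
    split; [exact H1|]. apply lead_left_neq with be; auto. }
  destruct (expand r m al be b (unit_vec O) Hr Hab Hfam) as [lam Hlam].
  (* [cb_basis] asks for orders at least k and m - k, so the factors [lam k] need no sign here; that
     they do not vanish is a consequence of the normalisation, through [cb_basis_lead]. *)
  exists (fun k j => lam k * b k j). split.
  - intros k Hk. destruct (Hb k Hk) as [H1 [H2 _]]. split; intros p Hp.
    + rewrite mom_scal, H1 by exact Hp. ring.
    + rewrite mom_scal, H2 by exact Hp. ring.
  - intros j Hj. rewrite Hlam by exact Hj. apply sum_eq. intros; ring.
Qed.

Lemma coefficients_exist (r : nat -> R) (m : nat) (al be : R) (B : nat -> nat -> R) (c : nat -> R) :
  strictly_incr r -> al < be -> cb_basis r m al be B ->
  exists lam, forall j, (j <= m)%nat -> c j = comb lam B m j.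
Proof.
  intros Hr Hab HB. apply expand with r al be; auto.
  apply cb_basis_left_family with be; auto.
Qed.

Lemma coefficients_unique (r : nat -> R) (m : nat) (al be : R) (B : nat -> nat -> R)
    (lam mu : nat -> R) :
  strictly_incr r -> al < be -> cb_basis r m al be B ->
  (forall j, (j <= m)%nat -> comb lam B m j = comb mu B m j) ->
  forall i, (i <= m)%nat -> lam i = mu i.
Proof.
  intros Hr Hab HB. apply comb_unique with r al.
  apply cb_basis_left_family with be; auto.
Qed.

(** * Dropping the lowest exponent: convexity of control polygons *)

Lemma telescoping (eta : nat -> R) (m i : nat) :
  sum_f_R0 (fun k => (eta (S k) - eta k) * (if Nat.leb (S k) i then 1 else 0)) m =
  eta (Nat.min i (S m)) - eta O.
Proof.
  induction m as [|m IH].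
  - simpl. destruct i as [|i]; simpl; [ring|]. rewrite Nat.min_0_r. ring.
  - rewrite tech5, IH. destruct (Nat.leb_spec (S (S m)) i).
    + rewrite !Nat.min_r by lia. ring.
    + rewrite !Nat.min_l by lia. ring.
Qed.

Lemma abel_summation (eta b : nat -> R) (m : nat) :
  sum_f_R0 (fun i => eta i * b i) (S m) =
  eta O * sum_f_R0 b (S m) +
  sum_f_R0 (fun k => (eta (S k) - eta k) *
    sum_f_R0 (fun i => (if Nat.leb (S k) i then 1 else 0) * b i) (S m)) m.
Proof.
  rewrite (sum_eq (fun k => (eta (S k) - eta k) * _) (fun k => sum_f_R0 (fun i =>
     (eta (S k) - eta k) * (if Nat.leb (S k) i then 1 else 0) * b i) (S m))).
  2:{ intros k _. rewrite <- sum_scal_l. apply sum_eq. intros; ring. }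
  rewrite sum_swap, <- sum_scal_l, <- plus_sum. apply sum_eq. intros i Hi.
  rewrite sum_scal_r, telescoping, Nat.min_l by lia. ring.
Qed.

(** Summation by parts writes f as eta_0 e^{r_0 v} plus the differences of eta times the tails, and
    [drop_low] kills the first term. The factors [c] normalise the derived basis and do not depend
    on f, so the differences belonging to two powers can be compared. *)
Lemma derived_basis (r : nat -> R) (m : nat) (al be : R) (B : nat -> nat -> R) :
  strictly_incr r -> al < be -> cb_basis r (S m) al be B ->
  exists c B', (forall k, (k <= m)%nat -> 0 < c k) /\
    cb_basis (fun j => r (S j)) m al be B' /\
    forall f eta, (forall j, (j <= S m)%nat -> f j = comb eta B (S m) j) ->
      forall j, (j <= m)%nat ->
        drop_low r f j = comb (fun k => (eta (S k) - eta k) / c k) B' m j.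
Proof.
  intros Hr Hab HB.
  set (beta := fun k => drop_low r (upper_sum B (S m) (S k))).
  set (r' := fun j => r (S j)).
  assert (Hr' : strictly_incr r') by (apply strictly_incr_shift; exact Hr).
  assert (Hbeta : forall k, (k <= m)%nat ->
            vanish r' m (beta k) k al /\ vanish r' m (beta k) (m - k) be /\
            0 < mom r' m (beta k) k al).
  { intros k Hk. destruct (upper_sum_facts r m al be B k Hr Hab HB Hk) as [H1 [H2 [H3 _]]].
    split; [exact H1|split; [exact H2|]]. apply lead_pos with be; auto.
    apply lead_left_neq with be; auto.
    apply (lead_nonzero r' m (beta k) 0 ((al + be) / 2)).
    specialize (H3 ((al + be) / 2) ltac:(lra)). fold r' in H3. fold (beta k) in H3. lra. }
  destruct (expand r' m al be beta (unit_vec O) Hr' Hab) as [c Hc].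
  { intros k Hk. destruct (Hbeta k Hk) as [H1 [_ H3]]. split; [exact H1|lra]. }
  assert (HB' : cb_basis r' m al be (fun k j => c k * beta k j)).
  { split.
    - intros k Hk. destruct (Hbeta k Hk) as [H1 [H2 _]]. split; intros p Hp.
      + rewrite mom_scal, H1 by exact Hp. ring.
      + rewrite mom_scal, H2 by exact Hp. ring.
    - intros j Hj. rewrite Hc by exact Hj. apply sum_eq. intros; ring. }
  assert (Hcpos : forall k, (k <= m)%nat -> 0 < c k).
  { intros k Hk. pose proof (cb_basis_lead r' m al be _ k Hr' Hab HB' Hk) as H.
    change (0 < mom r' m (fun j => c k * beta k j) k al) in H.
    rewrite mom_scal in H. destruct (Hbeta k Hk) as [_ [_ H3]].
    apply NNPP. intros Hn. nra. }
  exists c, (fun k j => c k * beta k j).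
  split; [exact Hcpos|split; [exact HB'|]].
  intros f eta Hf j Hj. unfold drop_low at 1. rewrite Hf by lia.
  unfold comb at 1. rewrite abel_summation.
  replace (sum_f_R0 (fun k => B k (S j)) (S m)) with 0.
  2:{ transitivity (unit_vec O (S j)); [reflexivity|].
      rewrite <- (proj2 HB (S j)) by lia. apply sum_eq. intros; ring. }
  rewrite Rmult_0_r, Rplus_0_l, <- sum_scal_l. unfold comb. apply sum_eq.
  intros k Hk. unfold beta, drop_low, upper_sum, comb.
  field. specialize (Hcpos k Hk). lra.
Qed.

Lemma drop_low_unit_vec (r : nat -> R) (j i : nat) :
  drop_low r (unit_vec (S j)) i = (r (S j) - r O) * unit_vec j i.
Proof.
  unfold drop_low, unit_vec.
  destruct (Nat.eq_dec (S j) (S i)), (Nat.eq_dec j i); try lia; [subst|]; ring.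
Qed.

Lemma comb_scal (x : R) (lam : nat -> R) (b : nat -> nat -> R) (m j : nat) :
  comb (fun k => x * lam k) b m j = x * comb lam b m j.
Proof. unfold comb. rewrite <- sum_scal_l. apply sum_eq. intros; ring. Qed.

Lemma comb_mom_eq (r : nat -> R) (m : nat) (f eta : nat -> R) (B : nat -> nat -> R)
    (p : nat) (v : R) :
  (forall j, (j <= m)%nat -> f j = comb eta B m j) ->
  mom r m f p v = sum_f_R0 (fun k => eta k * mom r m (B k) p v) m.
Proof. intros H. rewrite (mom_ext r m f _ p v H). apply mom_comb. Qed.

Lemma first_coefficient (r : nat -> R) (m : nat) (al be : R) (B : nat -> nat -> R)
    (f eta : nat -> R) :
  cb_basis r m al be B -> (forall j, (j <= m)%nat -> f j = comb eta B m j) ->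
  mom r m f 0 al = eta O * exp (r O * al).
Proof.
  intros HB H. rewrite (comb_mom_eq r m f eta B 0 al H), (sum_single _ m 0).
  - rewrite (cb_basis_left_end r m al be B HB). reflexivity.
  - lia.
  - intros i Hi Hi0. rewrite (proj1 (proj1 HB i Hi)) by lia. ring.
Qed.

Lemma last_coefficient (r : nat -> R) (m : nat) (al be : R) (B : nat -> nat -> R)
    (f eta : nat -> R) :
  cb_basis r m al be B -> (forall j, (j <= m)%nat -> f j = comb eta B m j) ->
  mom r m f 0 be = eta m * exp (r O * be).
Proof.
  intros HB H. rewrite (comb_mom_eq r m f eta B 0 be H), (sum_single _ m m).
  - rewrite (cb_basis_right_end r m al be B HB). reflexivity.
  - lia.
  - intros i Hi Hi0. rewrite (proj2 (proj1 HB i Hi)) by lia. ring.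
Qed.

Lemma unit_coefficients (r : nat -> R) (m : nat) (al be : R) (B : nat -> nat -> R)
    (eta : nat -> R) :
  strictly_incr r -> al < be -> cb_basis r m al be B ->
  (forall j, (j <= m)%nat -> unit_vec O j = comb eta B m j) ->
  forall k, (k <= m)%nat -> eta k = 1.
Proof.
  intros Hr Hab HB H.
  apply (coefficients_unique r m al be B eta (fun _ => 1) Hr Hab HB).
  intros j Hj. rewrite <- H by exact Hj. symmetry. apply HB. exact Hj.
Qed.

(** A power is an eigenfunction of d/dv - r_0, so its scaled differences are its own control points
    for the shifted exponents, where its index is one lower. *)
Lemma differences_of_power (r : nat -> R) (m : nat) (al be : R) (B : nat -> nat -> R)
    (j : nat) (eta c : nat -> R) (B' : nat -> nat -> R) :
  strictly_incr r ->
  (forall i, (i <= m)%nat -> drop_low r (unit_vec (S j)) i =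
     comb (fun k => (eta (S k) - eta k) / c k) B' m i) ->
  forall i, (i <= m)%nat -> unit_vec j i =
     comb (fun k => / (r (S j) - r O) * ((eta (S k) - eta k) / c k)) B' m i.
Proof.
  intros Hr H i Hi. rewrite comb_scal, <- H by exact Hi.
  rewrite drop_low_unit_vec. field.
  pose proof (strictly_incr_lt r 0 (S j) Hr ltac:(lia)). lra.
Qed.

(** Induction on j: the scaled differences are control points of a power of lower index, hence
    positive, and the first control point is positive by its value at [al]. *)
Lemma power_coefficients_pos (j : nat) : forall (r : nat -> R) (m : nat) (al be : R)
    (B : nat -> nat -> R) (eta : nat -> R),
  strictly_incr r -> al < be -> cb_basis r m al be B -> (j <= m)%nat ->
  (forall i, (i <= m)%nat -> unit_vec j i = comb eta B m i) ->
  forall k, (k <= m)%nat -> 0 < eta k.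
Proof.
  induction j as [|j IH]; intros r m al be B eta Hr Hab HB Hj Heta k Hk.
  - rewrite (unit_coefficients r m al be B eta) by assumption. lra.
  - destruct m as [|m]; [lia|].
    destruct (derived_basis r m al be B Hr Hab HB) as [c [B' [Hc [HB' HD]]]].
    pose proof (strictly_incr_lt r 0 (S j) Hr ltac:(lia)) as Hrj.
    assert (Hinc : forall k, (k <= m)%nat -> eta k < eta (S k)).
    { intros i Hi. specialize (Hc i Hi).
      assert (H : 0 < / (r (S j) - r O) * ((eta (S i) - eta i) / c i)).
      { apply (IH (fun j => r (S j)) m al be B'
                 (fun k => / (r (S j) - r O) * ((eta (S k) - eta k) / c k)));
          auto; [apply strictly_incr_shift; exact Hr|lia|].
        apply (differences_of_power r m al be B); [exact Hr|].
        intros i' Hi'. apply HD; [exact Heta|exact Hi']. }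
      assert (H1 : 0 < / (r (S j) - r O)) by (apply Rinv_0_lt_compat; lra).
      assert (H2 : 0 < / c i) by (apply Rinv_0_lt_compat; lra).
      apply NNPP. intros Hn.
      assert (0 <= / (r (S j) - r O) * ((eta i - eta (S i)) * / c i)).
      { apply Rmult_le_pos; [lra|]. apply Rmult_le_pos; lra. }
      unfold Rdiv in H. lra. }
    assert (H0 : 0 < eta O).
    { pose proof (first_coefficient r (S m) al be B _ eta HB Heta) as H.
      rewrite mom_unit_vec in H by lia. simpl in H.
      pose proof (exp_pos (r (S j) * al)). pose proof (exp_pos (r O * al)).
      apply NNPP. intros Hn. nra. }
    induction k as [|k IHk]; [exact H0|].
    apply Rlt_trans with (eta k); [apply IHk; lia|apply Hinc; lia].
Qed.

Lemma power_coefficients_incr (r : nat -> R) (m : nat) (al be : R) (B : nat -> nat -> R)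
    (j : nat) (eta : nat -> R) :
  strictly_incr r -> al < be -> cb_basis r m al be B -> (0 < j <= m)%nat ->
  (forall i, (i <= m)%nat -> unit_vec j i = comb eta B m i) ->
  forall k, (k < m)%nat -> eta k < eta (S k).
Proof.
  intros Hr Hab HB Hj Heta k Hk.
  destruct m as [|m]; [lia|]. destruct j as [|j]; [lia|].
  destruct (derived_basis r m al be B Hr Hab HB) as [c [B' [Hc [HB' HD]]]].
  pose proof (strictly_incr_lt r 0 (S j) Hr ltac:(lia)) as Hrj.
  specialize (Hc k ltac:(lia)).
  assert (H : 0 < / (r (S j) - r O) * ((eta (S k) - eta k) / c k)).
  { apply (power_coefficients_pos j (fun j => r (S j)) m al be B'
             (fun k => / (r (S j) - r O) * ((eta (S k) - eta k) / c k)));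
      auto; [apply strictly_incr_shift; exact Hr|lia| |lia].
    apply (differences_of_power r m al be B); [exact Hr|].
    intros i' Hi'. apply HD; [exact Heta|exact Hi']. }
  assert (H1 : 0 < / (r (S j) - r O)) by (apply Rinv_0_lt_compat; lra).
  assert (H2 : 0 < / c k) by (apply Rinv_0_lt_compat; lra).
  apply NNPP. intros Hn.
  assert (0 <= / (r (S j) - r O) * ((eta k - eta (S k)) * / c k)).
  { apply Rmult_le_pos; [lra|]. apply Rmult_le_pos; lra. }
  unfold Rdiv in H. lra.
Qed.

Lemma nondecreasing_seq (u : nat -> R) (m : nat) :
  (forall k, (k < m)%nat -> u k <= u (S k)) ->
  forall i k, (i <= k <= m)%nat -> u i <= u k.
Proof.
  intros H i k Hik. induction k as [|k IH].
  - replace i with O by lia. lra.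
  - destruct (Nat.eq_dec i (S k)) as [->|]; [lra|].
    apply Rle_trans with (u k); [apply IH; lia|apply H; lia].
Qed.

(** After [drop_low] the power t^{r_1} is the lowest one, with control points 1, so the differences
    of [xi] are proportional to [c]. The slopes are therefore proportional to the control points of
    t^{r_j} in the derived space, which increase. *)
Lemma power_polygon_convex (r : nat -> R) (m : nat) (al be : R) (B : nat -> nat -> R)
    (j : nat) (xi eta : nat -> R) :
  strictly_incr r -> al < be -> cb_basis r m al be B -> (2 <= j <= m)%nat ->
  (forall i, (i <= m)%nat -> unit_vec 1 i = comb xi B m i) ->
  (forall i, (i <= m)%nat -> unit_vec j i = comb eta B m i) ->
  exists s, (forall k, (k < m)%nat -> eta (S k) - eta k = s k * (xi (S k) - xi k)) /\
    forall k, (S k < m)%nat -> s k <= s (S k).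
Proof.
  intros Hr Hab HB Hj Hxi Heta.
  destruct m as [|m]; [lia|]. destruct j as [|j]; [lia|].
  destruct (derived_basis r m al be B Hr Hab HB) as [c [B' [Hc [HB' HD]]]].
  pose proof (strictly_incr_lt r 0 (S j) Hr ltac:(lia)) as Hrj.
  pose proof (strictly_incr_lt r 0 1 Hr ltac:(lia)) as Hr1.
  pose proof (strictly_incr_shift r Hr) as Hr'.
  set (q := fun k => / (r (S j) - r O) * ((eta (S k) - eta k) / c k)).
  assert (Hq : forall i, (i <= m)%nat -> unit_vec j i = comb q B' m i).
  { apply (differences_of_power r m al be B); [exact Hr|].
    intros i' Hi'. apply HD; [exact Heta|exact Hi']. }
  set (p := fun k => / (r 1%nat - r O) * ((xi (S k) - xi k) / c k)).
  assert (Hp : forall k, (k <= m)%nat -> p k = 1).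
  { apply (unit_coefficients _ m al be B' p Hr' Hab HB').
    apply (differences_of_power r m al be B); [exact Hr|].
    intros i' Hi'. apply HD; [exact Hxi|exact Hi']. }
  exists (fun k => (r (S j) - r O) * q k / (r 1%nat - r O)). split.
  - intros k Hk. specialize (Hp k ltac:(lia)). specialize (Hc k ltac:(lia)).
    unfold p in Hp. unfold q.
    assert (E : xi (S k) - xi k = (r 1%nat - r O) * c k).
    { rewrite <- (Rmult_1_r (_ * c k)), <- Hp. field. lra. }
    rewrite E. field. lra.
  - intros k Hk. pose proof (power_coefficients_incr _ m al be B' j q Hr' Hab HB'
        ltac:(lia) Hq k ltac:(lia)).
    unfold Rdiv. apply Rmult_le_compat_r; [left; apply Rinv_0_lt_compat; lra|].
    apply Rmult_le_compat_l; lra.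
Qed.

Lemma convex_above_line (xi eta s : nat -> R) (m i : nat) :
  (forall k, (k < m)%nat -> xi k < xi (S k)) ->
  (forall k, (k < m)%nat -> eta (S k) - eta k = s k * (xi (S k) - xi k)) ->
  (forall k, (S k < m)%nat -> s k <= s (S k)) -> (i < m)%nat ->
  forall k, (k <= m)%nat -> eta i + s i * (xi k - xi i) <= eta k.
Proof.
  intros Hxi Heta Hs Hi.
  assert (Hmono : forall k l, (k <= l)%nat -> (l < m)%nat -> s k <= s l).
  { intros k l Hkl Hl. apply (nondecreasing_seq s (pred m)); [|lia].
    intros k' Hk'. apply Hs. lia. }
  assert (Hup : forall d, (i + d <= m)%nat ->
            eta i + s i * (xi (i + d)%nat - xi i) <= eta (i + d)%nat).
  { induction d as [|d IH]; intros Hd.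
    - rewrite Nat.add_0_r. lra.
    - specialize (IH ltac:(lia)). rewrite Nat.add_succ_r.
      specialize (Heta (i + d)%nat ltac:(lia)). specialize (Hxi (i + d)%nat ltac:(lia)).
      pose proof (Hmono i (i + d)%nat ltac:(lia) ltac:(lia)). nra. }
  assert (Hdown : forall d, (d <= i)%nat ->
            eta i + s i * (xi (i - d)%nat - xi i) <= eta (i - d)%nat).
  { induction d as [|d IH]; intros Hd.
    - rewrite Nat.sub_0_r. lra.
    - specialize (IH ltac:(lia)).
      specialize (Heta (i - S d)%nat ltac:(lia)). specialize (Hxi (i - S d)%nat ltac:(lia)).
      replace (S (i - S d)) with (i - d)%nat in * by lia.
      pose proof (Hmono (i - S d)%nat i ltac:(lia) ltac:(lia)). nra. }
  intros k Hk. destruct (Nat.le_gt_cases i k).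
  - replace k with (i + (k - i))%nat by lia. apply Hup. lia.
  - replace k with (i - (i - k))%nat by lia. apply Hdown. lia.
Qed.

(** The line through an edge of a convex polygon lies below all vertices; averaging with the weights
    B_k(v), which are nonnegative with sum 1, puts it below the curve. *)
Lemma chord_below_curve (r : nat -> R) (m : nat) (al be : R) (B : nat -> nat -> R)
    (j : nat) (xi eta : nat -> R) (i : nat) :
  strictly_incr r -> r O = 0 -> al < be -> cb_basis r m al be B -> (2 <= j <= m)%nat ->
  (forall i, (i <= m)%nat -> unit_vec 1 i = comb xi B m i) ->
  (forall i, (i <= m)%nat -> unit_vec j i = comb eta B m i) -> (i < m)%nat ->
  exists s, eta (S i) - eta i = s * (xi (S i) - xi i) /\
    forall v, al <= v <= be ->
      eta i + s * (exp (r 1%nat * v) - xi i) <= exp (r j * v).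
Proof.
  intros Hr Hr0 Hab HB Hj Hxi Heta Hi.
  destruct (power_polygon_convex r m al be B j xi eta) as [s [Hs1 Hs2]]; auto.
  exists (s i). split; [apply Hs1; exact Hi|]. intros v Hv.
  assert (Hline : forall k, (k <= m)%nat -> eta i + s i * (xi k - xi i) <= eta k).
  { apply convex_above_line; auto.
    apply (power_coefficients_incr r m al be B 1 xi); auto. lia. }
  pose proof (cb_basis_sum r m al be B 0 v HB) as E0. rewrite Hr0, Rmult_0_l, exp_0 in E0.
  pose proof (comb_mom_eq r m _ xi B 0 v Hxi) as E1. rewrite mom_unit_vec in E1 by lia.
  pose proof (comb_mom_eq r m _ eta B 0 v Heta) as Ej. rewrite mom_unit_vec in Ej by lia.
  simpl in E0, E1, Ej. rewrite Rmult_1_l in E1, Ej. rewrite E1, Ej.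
  replace (eta i + s i * (sum_f_R0 (fun k => xi k * mom r m (B k) 0 v) m - xi i))
    with (sum_f_R0 (fun k => (eta i + s i * (xi k - xi i)) * mom r m (B k) 0 v) m).
  - apply sum_Rle. intros k Hk. apply Rmult_le_compat_r; [|apply Hline; exact Hk].
    apply cb_basis_nonneg with al be; auto.
  - rewrite (sum_eq _ (fun k => (eta i - s i * xi i) * mom r m (B k) 0 v
               + s i * (xi k * mom r m (B k) 0 v))) by (intros; ring).
    rewrite plus_sum, !sum_scal_l, E0. ring.
Qed.

(** * Dropping the highest exponent: comparison with [0, b] *)

Lemma comb_vanish_right (r : nat -> R) (m : nat) (al be : R) (B : nat -> nat -> R)
    (lam : nat -> R) (K : nat) :
  strictly_incr r -> al < be -> cb_basis r m al be B ->
  vanish r m (comb lam B m) K be ->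
  forall i, (i <= m)%nat -> (m - i < K)%nat -> lam i = 0.
Proof.
  intros Hr Hab HB Hv.
  apply (triangular m K (fun p i => mom r m (B i) p be) (fun i => m - i)%nat lam).
  - intros i p Hi Hp. apply HB; assumption.
  - intros i Hi. destruct (proj1 HB i Hi) as [H1 H2].
    apply lead_right_neq with al; auto. apply (lead_nonzero r m (B i) i al).
    pose proof (cb_basis_lead r m al be B i Hr Hab HB Hi). lra.
  - intros; lia.
  - intros p Hp. rewrite <- mom_comb. apply Hv; exact Hp.
Qed.

Lemma drop_high_comb (r : nat -> R) (m : nat) (f eta : nat -> R) (B : nat -> nat -> R)
    (N : nat) :
  (forall j, (j <= m)%nat -> f j = comb eta B N j) ->
  forall j, (j <= m)%nat ->
    drop_high r m f j = comb eta (fun k => drop_high r m (B k)) N j.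
Proof.
  intros H j Hj. unfold drop_high. rewrite H by exact Hj. unfold comb.
  rewrite <- sum_scal_l. apply sum_eq. intros; ring.
Qed.

(** [drop_high] costs B_k one order at each end, so its image involves only B'_{k-1} and B'_k. The
    two weights at each i add up to 1 because constants are fixed, r_0 being 0. Read backwards,
    eta_i is a convex combination of eta'_i and eta_{i+1}. *)
Lemma level_lowering (r : nat -> R) (m : nat) (al be : R) (B B' : nat -> nat -> R) :
  strictly_incr r -> r O = 0 -> al < be -> cb_basis r (S m) al be B ->
  cb_basis r m al be B' ->
  exists y, (forall i, (i <= m)%nat -> 0 <= y i) /\
    forall f eta eta', (forall j, (j <= S m)%nat -> f j = comb eta B (S m) j) ->
      (forall j, (j <= m)%nat -> drop_high r m f j = comb eta' B' m j) ->
      forall i, (i <= m)%nat -> eta' i = (1 + y i) * eta i - y i * eta (S i).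
Proof.
  intros Hr Hr0 Hab HB HB'.
  pose proof (strictly_incr_lt r 0 (S m) Hr ltac:(lia)) as HrS. rewrite Hr0 in HrS.
  assert (Hne : r (S m) <> 0) by lra.
  assert (Hex : forall k, exists lam, forall j, (j <= m)%nat ->
            drop_high r m (B k) j = comb lam B' m j).
  { intros k. apply coefficients_exist with r al be; auto. }
  destruct (seq_choice _ _ Hex) as [tau Htau].
  assert (Hlow : forall k i, (k <= S m)%nat -> (i <= m)%nat -> (S i < k)%nat -> tau k i = 0).
  { intros [|k] i Hk Hi Hik; [lia|].
    apply (comb_vanish_left r m al B' (tau (S k)) k); [|
      |exact Hi|lia].
    - apply cb_basis_left_family with be; auto.
    - apply vanish_ext with (drop_high r m (B (S k))); [apply Htau|].
      apply vanish_drop_high; [exact Hne|]. apply HB. exact Hk. }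
  assert (Hhigh : forall k i, (k <= S m)%nat -> (i <= m)%nat -> (k < i)%nat -> tau k i = 0).
  { intros k i Hk Hi Hik.
    apply (comb_vanish_right r m al be B' (tau k) (m - k)); auto; [|lia].
    apply vanish_ext with (drop_high r m (B k)); [apply Htau|].
    apply vanish_drop_high; [exact Hne|].
    replace (S (m - k)) with (S m - k)%nat by lia. apply HB. exact Hk. }
  assert (Hcoef : forall f eta eta',
            (forall j, (j <= S m)%nat -> f j = comb eta B (S m) j) ->
            (forall j, (j <= m)%nat -> drop_high r m f j = comb eta' B' m j) ->
            forall i, (i <= m)%nat -> eta' i = eta i * tau i i + eta (S i) * tau (S i) i).
  { intros f eta eta' Hf Hf' i Hi.
    rewrite <- (sum_pair (fun k => eta k * tau k i) m i Hi).
    - apply (coefficients_unique r m al be B' eta'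
               (fun i => sum_f_R0 (fun k => eta k * tau k i) (S m)) Hr Hab HB'); [|exact Hi].
      intros j Hj. rewrite <- Hf' by exact Hj.
      rewrite (drop_high_comb r m f eta B (S m)); [|intros; apply Hf; lia|exact Hj].
      unfold comb.
      rewrite (sum_eq _ (fun k => sum_f_R0 (fun i => eta k * tau k i * B' i j) m)).
      + rewrite sum_swap. apply sum_eq. intros i' _. rewrite sum_scal_r. reflexivity.
      + intros k Hk. rewrite Htau by exact Hj. unfold comb. rewrite <- sum_scal_l.
        apply sum_eq. intros; ring.
    - intros k Hk H1 H2. destruct (Nat.lt_ge_cases k i).
      + rewrite Hhigh by lia. ring.
      + rewrite Hlow by lia. ring. }
  assert (Hone : forall i, (i <= m)%nat -> tau i i + tau (S i) i = 1).
  { intros i Hi.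
    pose proof (Hcoef (unit_vec O) (fun _ => 1) (fun _ => 1)) as H.
    rewrite H with (i := i); [ring| | |exact Hi].
    - intros j Hj. symmetry. apply HB. exact Hj.
    - intros j Hj. rewrite (proj2 HB') by exact Hj. unfold drop_high, unit_vec.
      destruct (Nat.eq_dec 0 j) as [<-|]; [|ring]. rewrite Hr0. field. exact Hne. }
  (* Comparison of the i-th derivatives at [al]: on the image of B_{i+1} only the term -(d/dv) /
     r_{m+1} survives, and it is negative. *)
  assert (Hneg : forall i, (i <= m)%nat -> tau (S i) i <= 0).
  { intros i Hi.
    pose proof (cb_basis_lead r (S m) al be B (S i) Hr Hab HB ltac:(lia)) as H1.
    pose proof (cb_basis_lead r m al be B' i Hr Hab HB' Hi) as H2.
    pose proof (comb_mom_eq r m _ _ B' i al (Htau (S i))) as E.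
    rewrite mom_drop_high, (sum_single _ m i Hi) in E; [| |exact Hne].
    - rewrite (proj1 (proj1 HB (S i) ltac:(lia))) in E by lia.
      assert (0 < mom r (S m) (B (S i)) (S i) al / r (S m))
        by (apply Rdiv_lt_0_compat; lra).
      apply NNPP. intros Hn. nra.
    - intros l Hl Hli. destruct (Nat.lt_ge_cases l i).
      + rewrite Hlow by lia. ring.
      + rewrite (proj1 (proj1 HB' l Hl)) by lia. ring. }
  exists (fun i => - tau (S i) i). split.
  - intros i Hi. specialize (Hneg i Hi). lra.
  - intros f eta eta' Hf Hf' i Hi. rewrite (Hcoef f eta eta' Hf Hf' i Hi).
    specialize (Hone i Hi). replace (tau i i) with (1 - tau (S i) i) by lra. ring.
Qed.

(* prod_{l=k+1}^{m} (1 - x / r_l): at x = r_j, times b^{r_j}, this is the k-th control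
   point of t^{r_j} over [0, b]. *)
Fixpoint low_prod (r : nat -> R) (x : R) (k m : nat) : R :=
  match m with
  | O => 1
  | S m' => if Nat.leb k m' then low_prod r x k m' * (1 - x / r m) else 1
  end.

Lemma low_prod_diag (r : nat -> R) (x : R) (m : nat) : low_prod r x m m = 1.
Proof.
  destruct m as [|m]; [reflexivity|]. cbn [low_prod].
  destruct (Nat.leb_spec (S m) m); [lia|reflexivity].
Qed.

Lemma low_prod_succ (r : nat -> R) (x : R) (k m : nat) :
  (k <= m)%nat -> low_prod r x k (S m) = low_prod r x k m * (1 - x / r (S m)).
Proof. intros H. cbn [low_prod]. destruct (Nat.leb_spec k m); [reflexivity|lia]. Qed.

(* The control points over [a, b] are convex combinations of those over [0, b]. *)
Lemma control_points_nonneg (m : nat) : forall (r : nat -> R) (al be : R)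
    (B : nat -> nat -> R) (f eta : nat -> R) (k0 : nat),
  strictly_incr r -> r O = 0 -> al < be -> cb_basis r m al be B ->
  (forall j, (j <= m)%nat -> f j = comb eta B m j) ->
  (forall k, (k0 <= k <= m)%nat ->
     0 <= sum_f_R0 (fun j => f j * low_prod r (r j) k m * exp (r j * be)) m) ->
  forall k, (k0 <= k <= m)%nat -> 0 <= eta k.
Proof.
  induction m as [|m IH]; intros r al be B f eta k0 Hr Hr0 Hab HB Hf Hpos.
  - intros k Hk. replace k with O by lia.
    pose proof (last_coefficient r 0 al be B f eta HB Hf) as E.
    specialize (Hpos O ltac:(lia)). unfold mom in E. simpl in E, Hpos.
    rewrite Hr0, Rmult_0_l, exp_0 in *. lra.
  - assert (Htop : (k0 <= S m)%nat -> 0 <= eta (S m)).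
    { intros H.
      pose proof (last_coefficient r (S m) al be B f eta HB Hf) as E.
      specialize (Hpos (S m) ltac:(lia)). rewrite Hr0, Rmult_0_l, exp_0, Rmult_1_r in E.
      rewrite <- E. unfold mom.
      rewrite (sum_eq _ (fun j => f j * low_prod r (r j) (S m) (S m) * exp (r j * be)));
        [exact Hpos|].
      intros j _. rewrite low_prod_diag. reflexivity. }
    destruct (cb_basis_exists r m al be Hr Hab) as [B' HB'].
    destruct (level_lowering r m al be B B' Hr Hr0 Hab HB HB') as [y [Hy Hrec]].
    destruct (coefficients_exist r m al be B' (drop_high r m f) Hr Hab HB')
      as [eta' Heta'].
    specialize (Hrec f eta eta' Hf Heta').
    (* The last factor of each product passes into the coefficients of [drop_high r m f], and the
       term j = m + 1 carries the factor 0: the assumption for f becomes the one needed a level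
       lower. *)
    assert (Hpos' : forall k, (k0 <= k <= m)%nat -> 0 <= eta' k).
    { apply (IH r al be B' (drop_high r m f) eta' k0); auto.
      intros k Hk. specialize (Hpos k ltac:(lia)).
      rewrite tech5, low_prod_succ in Hpos by lia.
      replace (1 - r (S m) / r (S m)) with 0 in Hpos.
      - rewrite !Rmult_0_r, Rmult_0_l, Rplus_0_r in Hpos.
        rewrite (sum_eq _ (fun j => f j * low_prod r (r j) k (S m) * exp (r j * be)));
          [exact Hpos|].
        intros j Hj. rewrite low_prod_succ by lia. unfold drop_high. ring.
      - pose proof (strictly_incr_lt r 0 (S m) Hr ltac:(lia)). field. lra. }
    (* Descent from the value at [be]: eta_i is a convex combination of eta'_i and eta_{i+1}, so
       only indices from [k0] on are involved. *)
    assert (Hdesc : forall d, (k0 + d <= S m)%nat -> 0 <= eta (S m - d)%nat).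
    { induction d as [|d IHd]; intros Hd.
      - rewrite Nat.sub_0_r. apply Htop. lia.
      - specialize (IHd ltac:(lia)). replace (S m - d)%nat with (S (S m - S d)) in IHd by lia.
        specialize (Hrec (S m - S d)%nat ltac:(lia)).
        specialize (Hpos' (S m - S d)%nat ltac:(lia)).
        specialize (Hy (S m - S d)%nat ltac:(lia)). apply NNPP. intros Hn. nra. }
    intros k Hk. replace k with (S m - (S m - k))%nat by lia. apply Hdesc. lia.
Qed.

(** * Squeezing the control points when the series diverges *)

Lemma exp_le_exp (x y : R) : x <= y -> exp x <= exp y.
Proof. intros [H| ->]; [left; apply exp_increasing; exact H|lra]. Qed.

Lemma ln_le_ln (x y : R) : 0 < x -> x <= y -> ln x <= ln y.
Proof. intros Hx [H| ->]; [left; apply ln_increasing; assumption|lra]. Qed.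

Lemma ln_quot (x y : R) : 0 < x -> 0 < y -> ln (x / y) = ln x - ln y.
Proof.
  intros Hx Hy. unfold Rdiv. rewrite ln_mult, ln_Rinv; try assumption; [ring|].
  apply Rinv_0_lt_compat. exact Hy.
Qed.

Lemma ratio_bounds (r : nat -> R) (j l : nat) :
  strictly_incr r -> r O = 0 -> (j <= l)%nat -> (0 < l)%nat -> 0 <= r j / r l <= 1.
Proof.
  intros Hr Hr0 Hjl Hl.
  pose proof (strictly_incr_lt r 0 l Hr Hl).
  assert (0 <= r j).
  { destruct j as [|j]; [lra|]. pose proof (strictly_incr_lt r 0 (S j) Hr ltac:(lia)). lra. }
  assert (r j <= r l).
  { destruct (Nat.eq_dec j l) as [->|]; [lra|].
    pose proof (strictly_incr_lt r j l Hr ltac:(lia)). lra. }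
  split.
  - apply Rmult_le_pos; [assumption|]. left. apply Rinv_0_lt_compat. lra.
  - apply Rmult_le_reg_r with (r l); [lra|]. unfold Rdiv.
    rewrite Rmult_assoc, Rinv_l by lra. lra.
Qed.

Lemma low_prod_zero (r : nat -> R) (k m : nat) : low_prod r 0 k m = 1.
Proof.
  induction m as [|m IH]; [reflexivity|]. cbn [low_prod].
  destruct (Nat.leb k m); [|reflexivity]. rewrite IH. unfold Rdiv. ring.
Qed.

Lemma low_prod_nonneg (r : nat -> R) (j k m : nat) :
  strictly_incr r -> r O = 0 -> (j <= m)%nat -> 0 <= low_prod r (r j) k m.
Proof.
  intros Hr Hr0. induction m as [|m IH]; intros Hj; [simpl; lra|].
  cbn [low_prod]. destruct (Nat.leb k m); [|lra].
  destruct (Nat.eq_dec j (S m)) as [->|].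
  - pose proof (strictly_incr_lt r 0 (S m) Hr ltac:(lia)).
    replace (1 - r (S m) / r (S m)) with 0 by (field; lra). lra.
  - pose proof (ratio_bounds r j (S m) Hr Hr0 ltac:(lia) ltac:(lia)).
    apply Rmult_le_pos; [apply IH; lia|lra].
Qed.

Lemma low_prod_first_bounds (r : nat -> R) (k m : nat) :
  strictly_incr r -> r O = 0 -> 0 <= low_prod r (r 1%nat) k m <= 1.
Proof.
  intros Hr Hr0. induction m as [|m IH]; [simpl; lra|].
  cbn [low_prod]. destruct (Nat.leb k m); [|lra].
  pose proof (ratio_bounds r 1 (S m) Hr Hr0 ltac:(lia) ltac:(lia)). nra.
Qed.

Lemma low_prod_first_mono (r : nat -> R) (k K m : nat) :
  strictly_incr r -> r O = 0 -> (k <= K <= m)%nat ->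
  low_prod r (r 1%nat) k m <= low_prod r (r 1%nat) K m.
Proof.
  intros Hr Hr0. induction m as [|m IH]; intros Hk.
  - replace k with K by lia. lra.
  - destruct (Nat.eq_dec K (S m)) as [->|].
    + rewrite low_prod_diag. apply low_prod_first_bounds; assumption.
    + rewrite !low_prod_succ by lia.
      pose proof (ratio_bounds r 1 (S m) Hr Hr0 ltac:(lia) ltac:(lia)).
      apply Rmult_le_compat_r; [lra|apply IH; lia].
Qed.

(** Starts from the empty sum, so that the difference between m and K runs over exactly the factors
    K < l <= m of [low_prod r x K m]. *)
Definition inverse_sum (r : nat -> R) (m : nat) : R :=
  match m with
  | O => 0
  | S m' => sum_f_R0 (fun i => / r (S i)) m'
  end.

Lemma inverse_sum_succ (r : nat -> R) (m : nat) :
  inverse_sum r (S m) = inverse_sum r m + / r (S m).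
Proof. destruct m; simpl; [ring|reflexivity]. Qed.

Lemma low_prod_first_le_exp (r : nat -> R) (K m : nat) :
  strictly_incr r -> r O = 0 -> (K <= m)%nat ->
  low_prod r (r 1%nat) K m <= exp (- r 1%nat * (inverse_sum r m - inverse_sum r K)).
Proof.
  intros Hr Hr0 HK. induction m as [|m IH].
  - replace K with O by lia. rewrite Rminus_diag, Rmult_0_r, exp_0. simpl. lra.
  - destruct (Nat.eq_dec K (S m)) as [->|].
    + rewrite low_prod_diag, Rminus_diag, Rmult_0_r, exp_0. lra.
    + rewrite low_prod_succ, inverse_sum_succ by lia.
      replace (- r 1%nat * (inverse_sum r m + / r (S m) - inverse_sum r K))
        with (- r 1%nat * (inverse_sum r m - inverse_sum r K) + - (r 1%nat / r (S m)))
        by (unfold Rdiv; ring).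
      rewrite exp_plus.
      pose proof (ratio_bounds r 1 (S m) Hr Hr0 ltac:(lia) ltac:(lia)).
      pose proof (low_prod_first_bounds r K m Hr Hr0).
      pose proof (exp_ineq1_le (- (r 1%nat / r (S m)))).
      apply Rmult_le_compat; try lra. apply IH. lia.
Qed.

(** From e^z >= 1 + z and (1 + z)(1 - z + z^2) = 1 + z^3 >= 1. *)
Lemma exp_opp_le_quadratic (z : R) : 0 <= z -> exp (- z) <= 1 - z + z * z.
Proof.
  intros Hz. rewrite exp_Ropp. pose proof (exp_ineq1_le z).
  apply Rmult_le_reg_l with (exp z); [apply exp_pos|].
  rewrite Rinv_r by (pose proof (exp_pos z); lra).
  assert (0 <= 1 - z + z * z) by nra.
  apply Rle_trans with ((1 + z) * (1 - z + z * z)); [nra|].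
  apply Rmult_le_compat_r; lra.
Qed.

Lemma ln_le_pred (y : R) : 0 < y -> ln y <= y - 1.
Proof.
  intros Hy. pose proof (exp_ineq1_le (ln y)) as H. rewrite exp_ln in H by exact Hy. lra.
Qed.

(** With z = r_j / r_l, each factor satisfies (1 - r_1 / r_l)^{r_j / r_1} <= e^{-z} <= 1 - z + z^2.
    The error does not accumulate: if U - w <= eps, U <= 1 and z <= eps, then U (1 - z + z^2) - w (1
    - z) <= (1 - z) eps + z eps = eps. *)
Lemma low_prod_power_close (r : nat -> R) (j K : nat) (eps : R) :
  strictly_incr r -> r O = 0 -> (1 <= j <= K)%nat ->
  (forall l, (K < l)%nat -> r j / r l <= eps) -> 0 <= eps ->
  forall k m, (K <= k)%nat -> (k <= m)%nat ->
    0 < low_prod r (r 1%nat) k m /\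
    exp (r j / r 1%nat * ln (low_prod r (r 1%nat) k m)) <= low_prod r (r j) k m + eps.
Proof.
  intros Hr Hr0 Hj Hl Heps k m Hk. induction m as [|m IH]; intros Hm.
  - replace k with O by lia. simpl. rewrite ln_1, Rmult_0_r, exp_0. lra.
  - destruct (Nat.eq_dec k (S m)) as [->|].
    + rewrite !low_prod_diag, ln_1, Rmult_0_r, exp_0. lra.
    + destruct (IH ltac:(lia)) as [Hu HU]. rewrite !low_prod_succ by lia.
      pose proof (strictly_incr_lt r 0 1 Hr ltac:(lia)) as Hr1. rewrite Hr0 in Hr1.
      pose proof (strictly_incr_lt r 1 (S m) Hr ltac:(lia)) as HrS.
      pose proof (low_prod_first_bounds r k m Hr Hr0) as Hu1.
      pose proof (ratio_bounds r 1 (S m) Hr Hr0 ltac:(lia) ltac:(lia)) as Hy.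
      pose proof (ratio_bounds r j (S m) Hr Hr0 ltac:(lia) ltac:(lia)) as Hz.
      pose proof (ratio_bounds r 1 j Hr Hr0 ltac:(lia) ltac:(lia)) as Hs.
      specialize (Hl (S m) ltac:(lia)).
      set (u := low_prod r (r 1%nat) k m) in *. set (w := low_prod r (r j) k m) in *.
      set (sg := r j / r 1%nat) in *. set (z := r j / r (S m)) in *.
      assert (Hy1 : 0 < 1 - r 1%nat / r (S m)).
      { apply Rlt_0_minus. apply Rmult_lt_reg_r with (r (S m)); [lra|].
        unfold Rdiv. rewrite Rmult_assoc, Rinv_l by lra. lra. }
      assert (Hsg : 0 <= sg).
      { assert (Hrj : 0 < r j) by (rewrite <- Hr0; apply strictly_incr_lt; auto; lia).
        apply Rmult_le_pos; [lra|]. left. apply Rinv_0_lt_compat. exact Hr1. }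
      assert (HzE : z = sg * (r 1%nat / r (S m))) by (unfold z, sg; field; lra).
      split; [apply Rmult_lt_0_compat; assumption|].
      rewrite ln_mult, Rmult_plus_distr_l, exp_plus by assumption.
      set (U := exp (sg * ln u)) in *.
      assert (HU0 : 0 < U) by apply exp_pos.
      assert (HU1 : U <= 1).
      { unfold U. rewrite <- exp_0. pose proof (ln_le_pred u Hu).
        assert (Hle : sg * ln u <= 0) by nra.
        apply exp_le_exp; exact Hle. }
      assert (HV : exp (sg * ln (1 - r 1%nat / r (S m))) <= 1 - z + z * z).
      { apply Rle_trans with (exp (- z)); [|apply exp_opp_le_quadratic; lra].
        pose proof (ln_le_pred _ Hy1).
        assert (Hle : sg * ln (1 - r 1%nat / r (S m)) <= - z) by nra.
        apply exp_le_exp; exact Hle. }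
      apply Rle_trans with (U * (1 - z + z * z)).
      { apply Rmult_le_compat_l; lra. }
      assert ((1 - z) * (U - w) <= (1 - z) * eps) by (apply Rmult_le_compat_l; lra).
      assert (U * (z * z) <= z * eps) by nra.
      nra.
Qed.

(** Beyond some K all ratios r_j / r_l are small and [low_prod_power_close] applies. For k < K the
    product for r_1 is itself small, by divergence of the series, and its power r_j / r_1 >= 1 is no
    larger. *)
Lemma low_prod_limit (r : nat -> R) (j : nat) (eps : R) :
  strictly_incr r -> r O = 0 -> cv_infty r ->
  cv_infty (fun N => sum_f_R0 (fun i => / r (S i)) N) -> (1 <= j)%nat -> 0 < eps ->
  exists M, (j <= M)%nat /\ forall m k, (M <= m)%nat -> (k <= m)%nat ->
    0 < low_prod r (r 1%nat) k m ->
    exp (r j / r 1%nat * ln (low_prod r (r 1%nat) k m)) <= low_prod r (r j) k m + eps.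
Proof.
  intros Hr Hr0 Hinf Hsum Hj Heps.
  assert (Hrj : 0 < r j) by (rewrite <- Hr0; apply strictly_incr_lt; auto; lia).
  assert (Hr1 : 0 < r 1%nat) by (rewrite <- Hr0; apply strictly_incr_lt; auto; lia).
  destruct (Hinf (r j / eps)) as [N1 HN1].
  set (K := Nat.max j N1).
  assert (Hl : forall l, (K < l)%nat -> r j / r l <= eps).
  { intros l Hl. specialize (HN1 l ltac:(lia)).
    assert (0 < r l) by (rewrite <- Hr0; apply strictly_incr_lt; auto; lia).
    apply Rmult_le_reg_r with (r l); [lra|]. unfold Rdiv.
    rewrite Rmult_assoc, Rinv_l by lra.
    assert (eps * (r j / eps) <= eps * r l) by (apply Rmult_le_compat_l; lra).
    replace (eps * (r j / eps)) with (r j) in * by (field; lra). lra. }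
  (* This threshold makes the exponent X below at least 1 / eps, whence e^{-X} <= 1 / (1 + X) <=
     eps. *)
  destruct (Hsum (inverse_sum r K + / (eps * r 1%nat))) as [N2 HN2].
  exists (Nat.max K (S N2)). split; [lia|]. intros m k Hm Hkm Hu.
  destruct (Nat.le_gt_cases K k) as [HKk|HkK].
  - apply (low_prod_power_close r j K eps); auto; [lia|lra].
  - apply Rle_trans with (low_prod r (r 1%nat) k m).
    + pose proof (low_prod_first_bounds r k m Hr Hr0) as Hb.
      pose proof (ln_le_pred _ Hu) as Hln.
      pose proof (ratio_bounds r 1 j Hr Hr0 ltac:(lia) ltac:(lia)) as Hs.
      assert (1 <= r j / r 1%nat).
      { apply Rmult_le_reg_r with (r 1%nat); [lra|]. unfold Rdiv.
        rewrite Rmult_assoc, Rinv_l by lra.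
        destruct (Nat.eq_dec j 1) as [->|]; [lra|].
        pose proof (strictly_incr_lt r 1 j Hr ltac:(lia)). lra. }
      rewrite <- (exp_ln (low_prod r (r 1%nat) k m)) at 2 by exact Hu.
      assert (Hle : r j / r 1%nat * ln (low_prod r (r 1%nat) k m)
                    <= ln (low_prod r (r 1%nat) k m)) by nra.
      apply exp_le_exp; exact Hle.
    + pose proof (low_prod_nonneg r j k m Hr Hr0 ltac:(lia)).
      apply Rle_trans with eps; [|lra].
      apply Rle_trans with (low_prod r (r 1%nat) K m).
      { apply low_prod_first_mono; auto; lia. }
      apply Rle_trans with (exp (- r 1%nat * (inverse_sum r m - inverse_sum r K))).
      { apply low_prod_first_le_exp; auto; lia. }
      destruct m as [|m]; [lia|]. specialize (HN2 m ltac:(lia)).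
      change (sum_f_R0 (fun i => / r (S i)) m) with (inverse_sum r (S m)) in HN2.
      set (X := r 1%nat * (inverse_sum r (S m) - inverse_sum r K)).
      replace (- r 1%nat * (inverse_sum r (S m) - inverse_sum r K)) with (- X)
        by (unfold X; ring).
      assert (HX : / eps <= X).
      { replace (/ eps) with (r 1%nat * / (eps * r 1%nat)) by (field; lra).
        apply Rmult_le_compat_l; lra. }
      assert (He0 : 0 < / eps) by (apply Rinv_0_lt_compat; exact Heps).
      rewrite exp_Ropp, <- (Rinv_inv eps).
      apply Rinv_le_contravar; [exact He0|].
      pose proof (exp_ineq1_le X). lra.
Qed.

(** Bernoulli's inequality at e^x: the difference of the two sides is least at x = 0. *)
Lemma bernoulli_exp (sg x : R) : 1 <= sg -> 1 + sg * (exp x - 1) <= exp (sg * x).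
Proof.
  intros Hs.
  set (g := fun x => exp (sg * x) - sg * exp x).
  set (g' := fun x => exp (sg * x) * (sg * 1) - sg * exp x).
  assert (Hg : forall y, derivable_pt_lim g y (g' y)).
  { intros y. apply (derivable_pt_lim_minus (fun x => exp (sg * x)) (fun x => sg * exp x)).
    - apply (derivable_pt_lim_comp (fun x => sg * x) exp).
      + apply (derivable_pt_lim_scal (fun x => x)). apply derivable_pt_lim_id.
      + apply derivable_pt_lim_exp.
    - apply (derivable_pt_lim_scal exp). apply derivable_pt_lim_exp. }
  assert (H0 : g 0 = 1 - sg) by (unfold g; rewrite Rmult_0_r, exp_0; ring).
  assert (H : g 0 <= g x).
  { destruct (Rtotal_order x 0) as [Hx|[->|Hx]]; [|lra|].
    - destruct (MVT_cor2 g g' x 0 Hx) as [c [Hc1 Hc2]]; [intros; apply Hg|].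
      assert (exp (sg * c) <= exp c).
      { assert (Hle : sg * c <= c) by nra.
        apply exp_le_exp; exact Hle. }
      assert (g' c <= 0) by (unfold g'; nra). nra.
    - destruct (MVT_cor2 g g' 0 x Hx) as [c [Hc1 Hc2]]; [intros; apply Hg|].
      assert (exp c <= exp (sg * c)).
      { assert (Hle : c <= sg * c) by nra.
        apply exp_le_exp; exact Hle. }
      assert (0 <= g' c) by (unfold g'; nra). nra. }
  unfold g in H at 2. lra.
Qed.

(* Abscissa tau (in v = ln t) at which t^{r_1} takes the value xi_i. *)
Definition node (r xi : nat -> R) (i : nat) : R := ln (xi i) / r 1%nat.

Lemma power_at_node (r : nat -> R) (xi : nat -> R) (j i : nat) :
  exp (r j * node r xi i) = exp (r j / r 1%nat * ln (xi i)).
Proof. f_equal. unfold node, Rdiv. ring. Qed.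

Lemma first_power_at_node (r : nat -> R) (xi : nat -> R) (i : nat) :
  0 < r 1%nat -> 0 < xi i -> exp (r 1%nat * node r xi i) = xi i.
Proof.
  intros Hr Hx. unfold node. replace (r 1%nat * (ln (xi i) / r 1%nat)) with (ln (xi i))
    by (field; lra). apply exp_ln. exact Hx.
Qed.

(** Subtract from t^{r_j} the tangent of x^{r_j / r_1} at xi_i, taken at x = t^{r_1}, and add eps.
    By [low_prod_limit] and convexity all explicit points of this function are nonnegative, hence so
    are its control points; the one of index i is eta_i - xi_i^{r_j / r_1} + eps. *)
Lemma control_point_lower (r : nat -> R) (al be : R) (j : nat) (eps : R) :
  strictly_incr r -> r O = 0 -> cv_infty r ->
  cv_infty (fun N => sum_f_R0 (fun i => / r (S i)) N) -> al < be ->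
  (1 <= j)%nat -> 0 < eps ->
  exists M, (j <= M)%nat /\ forall m B xi eta, (M <= m)%nat -> cb_basis r m al be B ->
    (forall i, (i <= m)%nat -> unit_vec 1 i = comb xi B m i) ->
    (forall i, (i <= m)%nat -> unit_vec j i = comb eta B m i) ->
    forall i, (i <= m)%nat -> exp (r j * node r xi i) - eps <= eta i.
Proof.
  intros Hr Hr0 Hinf Hsum Hab Hj Heps.
  assert (Hr1 : 0 < r 1%nat) by (rewrite <- Hr0; apply strictly_incr_lt; auto; lia).
  assert (Hsg : 1 <= r j / r 1%nat).
  { apply Rmult_le_reg_r with (r 1%nat); [lra|]. unfold Rdiv.
    rewrite Rmult_assoc, Rinv_l by lra.
    destruct (Nat.eq_dec j 1) as [->|]; [lra|].
    pose proof (strictly_incr_lt r 1 j Hr ltac:(lia)). lra. }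
  (* The explicit points carry the factor b^{r_j}, which multiplies the error of the products. *)
  set (eps' := eps / exp (r j * be)).
  assert (Heps' : 0 < eps') by (apply Rdiv_lt_0_compat; [exact Heps|apply exp_pos]).
  destruct (low_prod_limit r j eps' Hr Hr0 Hinf Hsum Hj Heps') as [M [HjM HM]].
  exists M. split; [exact HjM|]. intros m B xi eta Hm HB Hxi Heta i Hi.
  assert (Hxi0 : 0 < xi i).
  { apply (power_coefficients_pos 1 r m al be B xi); auto. lia. }
  rewrite power_at_node.
  set (sg := r j / r 1%nat) in *. set (F0 := exp (sg * ln (xi i))).
  assert (HF0 : 0 < F0) by apply exp_pos.
  (* The tangent at xi_i is x |-> s x - F0 (sg - 1); [C] is eps minus its constant term. *)
  set (s := F0 * sg / xi i).
  set (C := eps + F0 * (sg - 1)).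
  assert (HC : 0 <= C) by (unfold C; nra).
  assert (H : 0 <= eta i + (- s) * xi i + C * 1).
  { apply (control_points_nonneg m r al be B
             (fun l => unit_vec j l + (- s) * unit_vec 1 l + C * unit_vec O l)
             (fun k => eta k + (- s) * xi k + C * 1) 0); auto; try lia.
    - intros l Hl. rewrite Hxi, Heta, <- (proj2 HB l Hl) by exact Hl.
      unfold comb. rewrite <- !sum_scal_l, <- !plus_sum. apply sum_eq. intros; ring.
    - intros k Hk.
      rewrite (sum_eq _ (fun l =>
         unit_vec j l * (low_prod r (r l) k m * exp (r l * be))
         + (- s) * (unit_vec 1 l * (low_prod r (r l) k m * exp (r l * be)))
         + C * (unit_vec O l * (low_prod r (r l) k m * exp (r l * be))))) by (intros; ring).
      rewrite !plus_sum, !sum_scal_l.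
      rewrite !(sum_unit_vec (fun l => low_prod r (r l) k m * exp (r l * be))) by lia.
      rewrite Hr0, low_prod_zero, Rmult_0_l, exp_0.
      pose proof (low_prod_nonneg r j k m Hr Hr0 ltac:(lia)) as Hw.
      pose proof (low_prod_first_bounds r k m Hr Hr0) as Hu.
      set (u := low_prod r (r 1%nat) k m) in *. set (w := low_prod r (r j) k m) in *.
      pose proof (exp_pos (r j * be)) as Ej. pose proof (exp_pos (r 1%nat * be)) as E1.
      (* At k = 0 the product u contains the factor 1 - r_1 / r_1 and ln u carries no information;
         there the tangent contributes nothing and C >= 0 suffices. *)
      destruct (Req_dec u 0) as [Hu0|Hu0].
      + rewrite Hu0. assert (0 <= w * exp (r j * be)) by (apply Rmult_le_pos; lra). nra.
      + specialize (HM m k Hm ltac:(lia) ltac:(fold u; lra)). fold u w sg in HM.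
        (* the tangent to x |-> x^(r_j/r_1) at xi_i lies below the graph *)
        pose proof (bernoulli_exp sg (ln u + r 1%nat * be - ln (xi i)) Hsg) as Hb.
        assert (Ex : exp (ln u + r 1%nat * be - ln (xi i)) = u * exp (r 1%nat * be) / xi i).
        { unfold Rminus. rewrite !exp_plus, exp_Ropp, !exp_ln by lra. reflexivity. }
        assert (Ey : exp (sg * (ln u + r 1%nat * be - ln (xi i)))
                     = exp (sg * ln u) * exp (r j * be) / F0).
        { replace (sg * (ln u + r 1%nat * be - ln (xi i)))
            with (sg * ln u + r j * be + - (sg * ln (xi i))) by (unfold sg; field; lra).
          rewrite !exp_plus, exp_Ropp. reflexivity. }
        rewrite Ex, Ey in Hb.
        apply (Rmult_le_compat_l F0) in Hb; [|lra].
        replace (F0 * (exp (sg * ln u) * exp (r j * be) / F0))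
          with (exp (sg * ln u) * exp (r j * be)) in Hb by (field; lra).
        replace (F0 * (1 + sg * (u * exp (r 1%nat * be) / xi i - 1)))
          with (s * (u * exp (r 1%nat * be)) - F0 * (sg - 1)) in Hb
          by (unfold s; field; lra).
        assert (Hc : exp (sg * ln u) * exp (r j * be) <= (w + eps') * exp (r j * be))
          by (apply Rmult_le_compat_r; lra).
        replace ((w + eps') * exp (r j * be)) with (w * exp (r j * be) + eps) in Hc
          by (unfold eps'; field; lra).
        unfold C. lra. }
  replace (s * xi i) with (F0 * sg) in H by (unfold s; field; lra).
  replace (- s * xi i) with (- (F0 * sg)) in H by (unfold s; field; lra).
  unfold C in H. lra.
Qed.

Lemma first_power_range (r : nat -> R) (m : nat) (al be : R) (B : nat -> nat -> R)
    (xi : nat -> R) :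
  strictly_incr r -> r O = 0 -> al < be -> cb_basis r m al be B -> (1 <= m)%nat ->
  (forall i, (i <= m)%nat -> unit_vec 1 i = comb xi B m i) ->
  xi O = exp (r 1%nat * al) /\ xi m = exp (r 1%nat * be) /\
  (forall i, (i < m)%nat -> xi i < xi (S i)) /\
  (forall i, (i <= m)%nat -> exp (r 1%nat * al) <= xi i <= exp (r 1%nat * be)).
Proof.
  intros Hr Hr0 Hab HB Hm Hxi.
  pose proof (first_coefficient r m al be B _ xi HB Hxi) as H0.
  pose proof (last_coefficient r m al be B _ xi HB Hxi) as H1.
  rewrite mom_unit_vec in H0, H1 by lia. rewrite Hr0, !Rmult_0_l, exp_0 in H0, H1.
  simpl in H0, H1.
  assert (Hinc : forall i, (i < m)%nat -> xi i < xi (S i)).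
  { apply (power_coefficients_incr r m al be B 1 xi); auto. }
  split; [lra|split; [lra|split; [exact Hinc|]]].
  intros i Hi.
  assert (Hmono : forall i k, (i <= k <= m)%nat -> xi i <= xi k).
  { apply nondecreasing_seq. intros k Hk. left. apply Hinc. exact Hk. }
  pose proof (Hmono O i ltac:(lia)). pose proof (Hmono i m ltac:(lia)). lra.
Qed.

Lemma ln_range (r1 al be x : R) :
  0 < r1 -> exp (r1 * al) <= x <= exp (r1 * be) -> al <= ln x / r1 <= be.
Proof.
  intros Hr Hx. pose proof (exp_pos (r1 * al)).
  assert (Hmul : r1 * al <= ln x <= r1 * be).
  { split.
    - rewrite <- (ln_exp (r1 * al)). apply ln_le_ln; lra.
    - rewrite <- (ln_exp (r1 * be)). apply ln_le_ln; lra. }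
  assert (E : ln x = r1 * (ln x / r1)) by (field; lra).
  rewrite E in Hmul. split; apply Rmult_le_reg_l with r1; lra.
Qed.

(** At the node of index i the line through the edge leaving the vertex i takes the value eta_i, and
    [chord_below_curve] applies. The last vertex has no such edge, but it lies on the curve. *)
Lemma control_point_upper (r : nat -> R) (m : nat) (al be : R) (B : nat -> nat -> R)
    (j : nat) (xi eta : nat -> R) :
  strictly_incr r -> r O = 0 -> al < be -> cb_basis r m al be B -> (1 <= j <= m)%nat ->
  (forall i, (i <= m)%nat -> unit_vec 1 i = comb xi B m i) ->
  (forall i, (i <= m)%nat -> unit_vec j i = comb eta B m i) ->
  forall i, (i <= m)%nat -> eta i <= exp (r j * node r xi i).
Proof.
  intros Hr Hr0 Hab HB Hj Hxi Heta i Hi.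
  assert (Hr1 : 0 < r 1%nat) by (rewrite <- Hr0; apply strictly_incr_lt; auto; lia).
  destruct (first_power_range r m al be B xi Hr Hr0 Hab HB ltac:(lia) Hxi)
    as [Hx0 [Hxm [Hinc Hrange]]].
  assert (Hxi0 : 0 < xi i).
  { apply (power_coefficients_pos 1 r m al be B xi); auto. lia. }
  destruct (Nat.eq_dec j 1) as [->|Hj1].
  - rewrite first_power_at_node by assumption. right.
    apply (coefficients_unique r m al be B eta xi Hr Hab HB); [|exact Hi].
    intros l Hl. rewrite <- Heta, <- Hxi by exact Hl. reflexivity.
  - destruct (Nat.eq_dec i m) as [->|Him].
    + pose proof (last_coefficient r m al be B _ eta HB Heta) as E.
      rewrite mom_unit_vec in E by lia. rewrite Hr0, Rmult_0_l, exp_0 in E. simpl in E.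
      right. unfold node. rewrite Hxm, ln_exp.
      replace (r j * (r 1%nat * be / r 1%nat)) with (r j * be) by (field; lra). lra.
    + destruct (chord_below_curve r m al be B j xi eta i) as [s [_ Hs]]; auto; try lia.
      specialize (Hs (node r xi i)). rewrite first_power_at_node in Hs by assumption.
      assert (al <= node r xi i <= be)
        by (apply ln_range; [exact Hr1|apply Hrange; exact Hi]).
      specialize (Hs ltac:(assumption)). lra.
Qed.

(** This is the gap at the midpoint between chord and graph of z^sg over [1, x]; its derivative (sg
    / 2) (x^{sg-1} - ((1 + x) / 2)^{sg-1}) is positive for x > 1. *)
Lemma midpoint_gap_increasing (sg x y : R) :
  1 < sg -> 1 <= x -> x < y ->
  (1 + Rpower x sg) / 2 - Rpower ((1 + x) / 2) sg <
  (1 + Rpower y sg) / 2 - Rpower ((1 + y) / 2) sg.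
Proof.
  intros Hs Hx Hxy.
  set (g := fun x => (1 + Rpower x sg) / 2 - Rpower ((1 + x) / 2) sg).
  set (g' := fun x => (/ 2) * (sg * Rpower x (sg - 1))
                      - (sg * Rpower ((1 + x) / 2) (sg - 1)) * / 2).
  destruct (MVT_cor2 g g' x y Hxy) as [c [Hc1 Hc2]].
  - intros c Hc.
    assert (H1 : derivable_pt_lim (fun z => (1 + Rpower z sg) / 2) c
                   (/ 2 * (sg * Rpower c (sg - 1)))).
    { apply (derivable_pt_lim_ext (fun z => / 2 * (1 + Rpower z sg)));
        [intros; unfold Rdiv; ring|].
      apply (derivable_pt_lim_scal (fun z => 1 + Rpower z sg)).
      replace (sg * Rpower c (sg - 1)) with (0 + sg * Rpower c (sg - 1)) by ring.
      apply (derivable_pt_lim_plus (fun _ => 1) (fun z => Rpower z sg)).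
      - apply derivable_pt_lim_const.
      - apply derivable_pt_lim_power. lra. }
    assert (H2 : derivable_pt_lim (fun z => Rpower ((1 + z) / 2) sg) c
                   ((sg * Rpower ((1 + c) / 2) (sg - 1)) * / 2)).
    { apply (derivable_pt_lim_comp (fun z => (1 + z) / 2) (fun z => Rpower z sg)).
      - apply (derivable_pt_lim_ext (fun z => / 2 * (1 + z)));
          [intros; unfold Rdiv; ring|].
        pose proof (derivable_pt_lim_scal _ (/ 2) c _ (derivable_pt_lim_plus _ _ c _ _
          (derivable_pt_lim_const 1 c) (derivable_pt_lim_id c))) as H2.
        rewrite Rplus_0_l, Rmult_1_r in H2. exact H2.
      - apply derivable_pt_lim_power. lra. }
    exact (derivable_pt_lim_minus _ _ c _ _ H1 H2).
  - assert (Hlt : Rpower ((1 + c) / 2) (sg - 1) < Rpower c (sg - 1))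
      by (apply Rlt_Rpower_l; lra).
    assert (0 < g' c) by (unfold g'; nra).
    unfold g in Hc1. nra.
Qed.

(** An edge with distant ends p < q would have both ends within d of the graph of x^{r_2 / r_1}, yet
    its midpoint below that graph. By homogeneity the gap of the graph is p^{r_2 / r_1} chi(q / p),
    which is bounded below when q / p >= e^{r_1 eps}. *)
Lemma mesh_small (r : nat -> R) (al be : R) (eps : R) :
  strictly_incr r -> r O = 0 -> cv_infty r ->
  cv_infty (fun N => sum_f_R0 (fun i => / r (S i)) N) -> al < be -> 0 < eps ->
  exists M, forall m B xi, (M <= m)%nat -> cb_basis r m al be B ->
    (forall i, (i <= m)%nat -> unit_vec 1 i = comb xi B m i) ->
    forall i, (i < m)%nat -> node r xi (S i) - node r xi i < eps.
Proof.
  intros Hr Hr0 Hinf Hsum Hab Heps.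
  assert (Hr1 : 0 < r 1%nat) by (rewrite <- Hr0; apply strictly_incr_lt; auto; lia).
  assert (Hr2 : r 1%nat < r 2%nat) by apply Hr.
  set (sg := r 2%nat / r 1%nat).
  assert (Hsg : 1 < sg).
  { apply Rmult_lt_reg_r with (r 1%nat); [lra|]. unfold sg, Rdiv.
    rewrite Rmult_assoc, Rinv_l by lra. lra. }
  set (chi := fun x => (1 + Rpower x sg) / 2 - Rpower ((1 + x) / 2) sg).
  set (R0 := exp (r 1%nat * eps)).
  assert (HR0 : 1 < R0).
  { unfold R0. rewrite <- exp_0. apply exp_increasing. nra. }
  assert (Hchi0 : chi 1 = 0).
  { unfold chi. replace ((1 + 1) / 2) with 1 by field. unfold Rpower.
    rewrite ln_1, Rmult_0_r, exp_0. field. }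
  assert (Hchi : 0 < chi R0).
  { rewrite <- Hchi0. apply midpoint_gap_increasing; lra. }
  (* Half of the least possible gap, since p^{r_2 / r_1} >= a^{r_2}. *)
  set (d := chi R0 * exp (r 2%nat * al) / 2).
  assert (Hd : 0 < d).
  { unfold d. pose proof (exp_pos (r 2%nat * al)). nra. }
  destruct (control_point_lower r al be 2 d Hr Hr0 Hinf Hsum Hab ltac:(lia) Hd)
    as [M [HM2 HM]].
  exists M. intros m B xi Hm HB Hxi i Hi. apply Rnot_le_lt. intros Hgap.
  destruct (first_power_range r m al be B xi Hr Hr0 Hab HB ltac:(lia) Hxi)
    as [Hx0 [Hxm [Hinc Hrange]]].
  destruct (coefficients_exist r m al be B (unit_vec 2) Hr Hab HB) as [eta Heta].
  pose proof (HM m B xi eta Hm HB Hxi Heta i ltac:(lia)) as Hl1.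
  pose proof (HM m B xi eta Hm HB Hxi Heta (S i) ltac:(lia)) as Hl2.
  destruct (chord_below_curve r m al be B 2 xi eta i) as [s [Hs1 Hs2]]; auto; try lia.
  pose proof (Hrange i ltac:(lia)) as Hri. pose proof (Hrange (S i) ltac:(lia)) as Hri'.
  pose proof (exp_pos (r 1%nat * al)).
  set (p := xi i) in *. set (q := xi (S i)) in *.
  specialize (Hs2 (ln ((p + q) / 2) / r 1%nat)
    (ln_range (r 1%nat) al be ((p + q) / 2) Hr1 ltac:(lra))).
  replace (r 1%nat * (ln ((p + q) / 2) / r 1%nat)) with (ln ((p + q) / 2)) in Hs2
    by (field; lra).
  rewrite exp_ln in Hs2 by lra.
  replace (r 2%nat * (ln ((p + q) / 2) / r 1%nat)) with (sg * ln ((p + q) / 2)) in Hs2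
    by (unfold sg; field; lra).
  rewrite power_at_node in Hl1, Hl2. fold sg in Hl1, Hl2. fold p in Hl1. fold q in Hl2.
  assert (HqR : R0 <= q / p).
  { unfold R0. rewrite <- (exp_ln (q / p)) by (apply Rdiv_lt_0_compat; lra).
    assert (Hle : r 1%nat * eps <= ln (q / p)).
    { rewrite ln_quot by lra. unfold node in Hgap. fold p q in Hgap.
      replace (ln q - ln p) with (r 1%nat * (ln q / r 1%nat - ln p / r 1%nat))
        by (field; lra).
      apply Rmult_le_compat_l; lra. }
    apply exp_le_exp; exact Hle. }
  assert (HchiR : chi R0 <= chi (q / p)).
  { destruct HqR as [Hlt|Heq]; [left; apply midpoint_gap_increasing; lra|rewrite Heq; lra]. }
  set (ps := exp (sg * ln p)) in *.
  assert (Hps : exp (r 2%nat * al) <= ps).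
  { unfold ps. assert (Hle : r 2%nat * al <= sg * ln p).
    { pose proof (ln_range (r 1%nat) al be p Hr1 ltac:(lra)).
      replace (sg * ln p) with (r 2%nat * (ln p / r 1%nat)) by (unfold sg; field; lra).
      apply Rmult_le_compat_l; lra. }
    apply exp_le_exp; exact Hle. }
  assert (Eq : exp (sg * ln q) = ps * Rpower (q / p) sg).
  { unfold ps, Rpower. rewrite <- exp_plus. f_equal. rewrite ln_quot by lra. ring. }
  assert (Em : exp (sg * ln ((p + q) / 2)) = ps * Rpower ((1 + q / p) / 2) sg).
  { unfold ps, Rpower. rewrite <- exp_plus. f_equal.
    replace ((p + q) / 2) with (p * ((1 + q / p) / 2)) by (field; lra).
    rewrite ln_mult; [ring|lra|].
    assert (0 < q / p) by (apply Rdiv_lt_0_compat; lra). lra. }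
  assert (Hmid : (eta i + eta (S i)) / 2 <= exp (sg * ln ((p + q) / 2))).
  { replace ((eta i + eta (S i)) / 2) with (eta i + s * ((p + q) / 2 - p)); [exact Hs2|].
    replace (eta (S i)) with (eta i + s * (q - p)) by lra. field. }
  rewrite Em in Hmid. rewrite Eq in Hl2.
  assert (Hfin : ps * chi (q / p) <= d) by (unfold chi; lra).
  pose proof (exp_pos (r 2%nat * al)).
  assert (exp (r 2%nat * al) * chi R0 <= ps * chi (q / p)) by (apply Rmult_le_compat; lra).
  unfold d in Hfin. nra.
Qed.

(** * Both directions of the equivalence *)

Lemma control_points_close (r : nat -> R) (al be : R) (n : nat) (eps : R) :
  strictly_incr r -> r O = 0 -> cv_infty r ->
  cv_infty (fun N => sum_f_R0 (fun i => / r (S i)) N) -> al < be -> 0 < eps ->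
  exists M, forall m B xi, (M <= m)%nat -> cb_basis r m al be B ->
    (forall i, (i <= m)%nat -> unit_vec 1 i = comb xi B m i) ->
    forall k eta, (k <= n)%nat ->
      (forall i, (i <= m)%nat -> unit_vec k i = comb eta B m i) ->
      forall i, (i <= m)%nat -> Rabs (exp (r k * node r xi i) - eta i) <= eps.
Proof.
  intros Hr Hr0 Hinf Hsum Hab Heps. induction n as [|n [M IH]].
  - exists O. intros m B xi _ HB _ k eta Hk Heta i Hi. replace k with O in * by lia.
    rewrite (unit_coefficients r m al be B eta Hr Hab HB Heta i Hi).
    rewrite Hr0, Rmult_0_l, exp_0, Rminus_diag, Rabs_R0. lra.
  - destruct (control_point_lower r al be (S n) eps Hr Hr0 Hinf Hsum Hab ltac:(lia) Heps)
      as [M' [HM1 HM2]].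
    exists (Nat.max M M'). intros m B xi Hm HB Hxi k eta Hk Heta i Hi.
    destruct (Nat.eq_dec k (S n)) as [->|].
    + pose proof (HM2 m B xi eta ltac:(lia) HB Hxi Heta i Hi).
      pose proof (control_point_upper r m al be B (S n) xi eta Hr Hr0 Hab HB ltac:(lia)
                    Hxi Heta i Hi).
      apply Rabs_le. lra.
    + apply (IH m B xi ltac:(lia) HB Hxi k eta); auto. lia.
Qed.

(** * Control points and basis functions when the series converges *)

Lemma low_prod_ge (r : nat -> R) (j k m : nat) :
  strictly_incr r -> r O = 0 -> (j <= k <= m)%nat ->
  1 - r j * (inverse_sum r m - inverse_sum r k) <= low_prod r (r j) k m <= 1.
Proof.
  intros Hr Hr0. induction m as [|m IH]; intros Hk.
  - replace k with O by lia. simpl. lra.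
  - destruct (Nat.eq_dec k (S m)) as [->|].
    + rewrite low_prod_diag. lra.
    + rewrite low_prod_succ, inverse_sum_succ by lia. specialize (IH ltac:(lia)).
      pose proof (ratio_bounds r j (S m) Hr Hr0 ltac:(lia) ltac:(lia)) as Hy.
      pose proof (low_prod_nonneg r j k m Hr Hr0 ltac:(lia)).
      unfold Rdiv in *. nra.
Qed.

Lemma inverse_sum_mono (r : nat -> R) (k m : nat) :
  strictly_incr r -> r O = 0 -> (k <= m)%nat -> inverse_sum r k <= inverse_sum r m.
Proof.
  intros Hr Hr0 Hk. apply (nondecreasing_seq (inverse_sum r) m); [|lia].
  intros i _. rewrite inverse_sum_succ.
  assert (0 < r (S i)) by (rewrite <- Hr0; apply strictly_incr_lt; auto; lia).
  assert (0 < / r (S i)) by (apply Rinv_0_lt_compat; assumption). lra.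
Qed.

(** The function t^{r_j} minus the constant b^{r_j} / 2 has nonnegative explicit points from index K
    on, because a product of terms 1 - x_l is at least 1 minus the sum of the x_l. *)
Lemma control_points_large (r : nat -> R) (m : nat) (al be : R) (B : nat -> nat -> R)
    (j K : nat) (eta : nat -> R) :
  strictly_incr r -> r O = 0 -> al < be -> cb_basis r m al be B -> (j <= K)%nat ->
  r j * (inverse_sum r m - inverse_sum r K) <= / 2 ->
  (forall i, (i <= m)%nat -> unit_vec j i = comb eta B m i) ->
  forall i, (K <= i <= m)%nat -> exp (r j * be) / 2 <= eta i.
Proof.
  intros Hr Hr0 Hab HB Hj Hsum Heta i Hi.
  set (C := exp (r j * be) / 2).
  assert (H : 0 <= eta i + (- C) * 1).
  { apply (control_points_nonneg m r al be B
             (fun l => unit_vec j l + (- C) * unit_vec O l)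
             (fun k => eta k + (- C) * 1) K); auto.
    - intros l Hl. rewrite Heta, <- (proj2 HB l Hl) by exact Hl.
      unfold comb. rewrite <- !sum_scal_l, <- !plus_sum. apply sum_eq. intros; ring.
    - intros k Hk.
      rewrite (sum_eq _ (fun l =>
         unit_vec j l * (low_prod r (r l) k m * exp (r l * be))
         + (- C) * (unit_vec O l * (low_prod r (r l) k m * exp (r l * be))))) by (intros; ring).
      rewrite !plus_sum, !sum_scal_l.
      rewrite !(sum_unit_vec (fun l => low_prod r (r l) k m * exp (r l * be))) by lia.
      rewrite Hr0, low_prod_zero, Rmult_0_l, exp_0.
      pose proof (low_prod_ge r j k m Hr Hr0 ltac:(lia)) as Hlow.
      pose proof (inverse_sum_mono r K k Hr Hr0 ltac:(lia)).
      assert (0 <= r j).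
      { destruct j; [lra|]. left. rewrite <- Hr0. apply strictly_incr_lt; auto; lia. }
      assert (Hw : / 2 <= low_prod r (r j) k m) by nra.
      pose proof (exp_pos (r j * be)). unfold C. nra. }
  lra.
Qed.

(* The Bernstein masses at an interior point do not escape to large indices: the moment
   t^{r_j} with r_j large sees the indices beyond K as if they sat at t = b. *)
Lemma bernstein_mass_tight (r : nat -> R) (al be v eps : R) :
  strictly_incr r -> r O = 0 -> cv_infty r -> al <= v < be -> 0 < eps ->
  (forall d, 0 < d -> exists K0, forall K m, (K0 <= K)%nat -> (K <= m)%nat ->
     inverse_sum r m - inverse_sum r K <= d) ->
  exists K, forall m B, (K <= m)%nat -> cb_basis r m al be B ->
    sum_f_R0 (fun i => (if Nat.leb K i then 1 else 0) * mom r m (B i) 0 v) m <= eps.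
Proof.
  intros Hr Hr0 Hinf Hv Heps Hcauchy.
  assert (Hab : al < be) by lra.
  (* Chosen so that X = r_j (be - v) exceeds 2 / eps; then e^X > 2 / eps, while the mass is at most
     2 e^{-X}. *)
  destruct (Hinf (2 / (eps * (be - v)))) as [j0 Hj0].
  set (j := S j0). specialize (Hj0 j ltac:(unfold j; lia)).
  assert (Hrj : 0 < r j) by (rewrite <- Hr0; apply strictly_incr_lt; auto; unfold j; lia).
  (* Tail sums below 1 / (2 r_j) keep the products for r_j above 1/2. *)
  destruct (Hcauchy (/ (2 * r j))) as [K0 HK0]; [apply Rinv_0_lt_compat; lra|].
  exists (Nat.max j K0). set (K := Nat.max j K0). intros m B Hm HB.
  destruct (coefficients_exist r m al be B (unit_vec j) Hr Hab HB) as [eta Heta].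
  assert (Hlarge : forall i, (K <= i <= m)%nat -> exp (r j * be) / 2 <= eta i).
  { apply (control_points_large r m al be B j K eta); auto; [unfold K; lia|].
    specialize (HK0 K m ltac:(unfold K; lia) ltac:(lia)).
    apply Rle_trans with (r j * / (2 * r j)); [apply Rmult_le_compat_l; lra|].
    right. field. lra. }
  pose proof (power_coefficients_pos j r m al be B eta Hr Hab HB
                ltac:(unfold K in Hm; lia) Heta) as Hpos.
  pose proof (comb_mom_eq r m _ eta B 0 v Heta) as E.
  rewrite mom_unit_vec in E by (unfold K in Hm; lia). simpl in E. rewrite Rmult_1_l in E.
  set (T := sum_f_R0 (fun i => (if Nat.leb K i then 1 else 0) * mom r m (B i) 0 v) m).
  assert (HT : exp (r j * be) / 2 * T <= exp (r j * v)).
  { rewrite E. unfold T. rewrite <- sum_scal_l. apply sum_Rle. intros i Hi.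
    pose proof (cb_basis_nonneg r m al be B i v Hr Hab HB Hi ltac:(lra)) as HBi.
    specialize (Hpos i Hi). destruct (Nat.leb_spec K i).
    - specialize (Hlarge i ltac:(lia)). rewrite Rmult_1_l. apply Rmult_le_compat_r; assumption.
    - rewrite Rmult_0_l, Rmult_0_r. apply Rmult_le_pos; lra. }
  set (X := r j * (be - v)).
  assert (HX : 2 / eps < X).
  { unfold X. apply Rmult_lt_reg_r with (/ (be - v)); [apply Rinv_0_lt_compat; lra|].
    replace (2 / eps * / (be - v)) with (2 / (eps * (be - v))) by (field; lra).
    rewrite Rmult_assoc, Rinv_r by lra. lra. }
  assert (Ebe : exp (r j * be) = exp (r j * v) * exp X)
    by (unfold X; rewrite <- exp_plus; f_equal; ring).
  rewrite Ebe in HT. pose proof (exp_pos (r j * v)). pose proof (exp_ineq1_le X).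
  assert (HT2 : exp X * T <= 2).
  { apply Rmult_le_reg_l with (exp (r j * v)); [assumption|]. lra. }
  assert (0 < 2 / eps) by (apply Rdiv_lt_0_compat; lra).
  apply Rmult_le_reg_l with (2 / eps); [assumption|].
  replace (2 / eps * eps) with 2 by (field; lra).
  assert (0 <= T).
  { apply sum_nonneg. intros i Hi. apply Rmult_le_pos; [destruct (Nat.leb K i); lra|].
    apply cb_basis_nonneg with al be; auto. lra. }
  apply Rle_trans with (exp X * T); [|exact HT2]. apply Rmult_le_compat_r; lra.
Qed.

(** The partial sums are nondecreasing, so if they do not tend to infinity they are bounded and
    converge. *)
Lemma inverse_sum_cauchy (r : nat -> R) :
  strictly_incr r -> r O = 0 ->
  ~ cv_infty (fun N => sum_f_R0 (fun i => / r (S i)) N) ->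
  forall d, 0 < d -> exists K0, forall K m, (K0 <= K)%nat -> (K <= m)%nat ->
    inverse_sum r m - inverse_sum r K <= d.
Proof.
  intros Hr Hr0 Hn.
  assert (Hbd : exists C, forall m, inverse_sum r m <= C).
  { apply NNPP. intros Hno. apply Hn. intros C.
    destruct (classic (exists m, C < inverse_sum r m)) as [[m Hm]|Hno'].
    - exists m. intros k Hk. change (C < inverse_sum r (S k)).
      pose proof (inverse_sum_mono r m (S k) Hr Hr0 ltac:(lia)). lra.
    - exfalso. apply Hno. exists C. intros m. apply Rnot_lt_le. intros H.
      apply Hno'. exists m. exact H. }
  destruct Hbd as [C HC].
  destruct (growing_cv (inverse_sum r)) as [l Hl].
  - intros k. apply inverse_sum_mono; auto.
  - exists C. intros x [k ->]. apply HC.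
  - intros d Hd. destruct (Hl (d / 2)) as [K0 HK0]; [lra|]. exists K0.
    intros K m HK Hm. pose proof (HK0 K ltac:(lia)) as H1. pose proof (HK0 m ltac:(lia)) as H2.
    unfold Rdist in *. apply Rabs_def2 in H1, H2. lra.
Qed.

(** * Passage from the variable t to v = ln t *)

Lemma muntz_fun_mom (r : nat -> R) (m : nat) (c : nat -> R) (t : R) :
  muntz_fun r m c t = mom r m c 0 (ln t).
Proof. unfold muntz_fun, mom, Rpower. apply sum_eq. intros; simpl; ring. Qed.

(** Derivatives in t produce falling factorials of r_j, derivatives in v produce powers. Writing x =
    (x - p) + p trades a factor of the power for one of the factorial, by induction on the exponent
    q of the power. *)
Lemma vanish_of_derivatives (r : nat -> R) (m : nat) (c : nat -> R) (k : nat) (x : R) :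
  (forall p, (p < k)%nat -> muntz_deriv r m c p x = 0) -> vanish r m c k (ln x).
Proof.
  intros H.
  assert (H1 : forall q p, (q + p < k)%nat ->
            sum_f_R0 (fun j => c j * r j ^ q * falling (r j) p * exp (r j * ln x)) m = 0).
  { induction q as [|q IH]; intros p Hp.
    - specialize (H p ltac:(lia)). unfold muntz_deriv, Rpower in H.
      rewrite (sum_eq _ (fun j => exp (- INR p * ln x) *
                 (c j * r j ^ 0 * falling (r j) p * exp (r j * ln x)))) in H.
      + rewrite sum_scal_l in H. pose proof (exp_pos (- INR p * ln x)).
        apply Rmult_integral in H. destruct H as [H|H]; [lra|exact H].
      + intros j _. replace ((r j - INR p) * ln x) with (- INR p * ln x + r j * ln x) by ring.
        rewrite exp_plus. simpl. ring.
    - rewrite (sum_eq _ (fun j =>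
          c j * r j ^ q * falling (r j) (S p) * exp (r j * ln x)
          + INR p * (c j * r j ^ q * falling (r j) p * exp (r j * ln x))))
        by (intros; simpl; ring).
      rewrite plus_sum, sum_scal_l, !IH by lia. ring. }
  intros p Hp. rewrite <- (H1 p O) by lia. apply sum_eq. intros j _. simpl. ring.
Qed.

Lemma coefficients_of_function (r : nat -> R) (m : nat) (c d : nat -> R) :
  strictly_incr r -> (forall v, mom r m c 0 v = mom r m d 0 v) ->
  forall j, (j <= m)%nat -> c j = d j.
Proof.
  intros Hr H j Hj. apply Rminus_diag_uniq.
  apply (zero_on_interval r m (fun j => c j - d j) 0 1 Hr); [lra| |exact Hj].
  intros v _. rewrite (mom_ext r m _ (fun j => c j + (-1) * d j)) by (intros; ring).
  rewrite mom_plus, mom_scal, H. ring.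
Qed.

Lemma cb_basis_of_IsCBBasis (r : nat -> R) (a b : R) (m : nat) (Bc : nat -> nat -> R) :
  strictly_incr r -> r O = 0 -> IsCBBasis r a b m Bc -> cb_basis r m (ln a) (ln b) Bc.
Proof.
  intros Hr Hr0 [_ [Hsum Hz]]. split.
  - intros k Hk. destruct (Hz k Hk) as [[H1 _] [H2 _]].
    split; apply vanish_of_derivatives; assumption.
  - apply (coefficients_of_function r m); [exact Hr|]. intros v.
    rewrite mom_comb, mom_unit_vec, Hr0, Rmult_0_l, exp_0 by lia.
    simpl pow. rewrite Rmult_1_l.
    transitivity (sum_f_R0 (fun k => muntz_fun r m (Bc k) (exp v)) m);
      [|apply Hsum; apply exp_pos].
    apply sum_eq. intros k _. rewrite muntz_fun_mom, ln_exp. ring.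
Qed.

(** Padded with zeros beyond n, so that one vector represents the component at every level m >=
    n. *)
Definition curve_coefficients (n : nat) (A : nat -> nat -> R) (c : nat) : nat -> R :=
  comb (fun k => A k c) unit_vec n.

Lemma curve_mom (r : nat -> R) (n m : nat) (A : nat -> nat -> R) (c : nat) (t : R) :
  (n <= m)%nat -> curve r n A t c = mom r m (curve_coefficients n A c) 0 (ln t).
Proof.
  intros Hm. unfold curve_coefficients. rewrite mom_comb. unfold curve, Rpower.
  apply sum_eq. intros k Hk. rewrite mom_unit_vec by lia. simpl. ring.
Qed.

Lemma fold_right_Rmax_lt (l : list nat) (f : nat -> R) (eps : R) :
  0 < eps -> (fold_right Rmax 0 (map f l) < eps <-> forall x, In x l -> f x < eps).
Proof.
  intros He. induction l as [|y l IH]; simpl.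
  - split; [tauto|lra].
  - split.
    + intros H x [<-|Hx].
      * eapply Rle_lt_trans; [apply Rmax_l|exact H].
      * apply IH; [|exact Hx]. eapply Rle_lt_trans; [apply Rmax_r|exact H].
    + intros H. apply Rmax_lub_lt; [apply H; auto|]. apply IH. auto.
Qed.

Lemma norm_inf_lt (s : nat) (v : nat -> R) (eps : R) :
  0 < eps -> (norm_inf s v < eps <-> forall c, (c < s)%nat -> Rabs (v c) < eps).
Proof.
  intros He. unfold norm_inf. rewrite fold_right_Rmax_lt by exact He.
  split; intros H c Hc; apply H; apply in_seq in Hc || apply in_seq; lia.
Qed.

Lemma polygons_converge_of_divergent_sum (r : nat -> R) (a b : R) (n s : nat) (A : nat -> nat -> R)
    (Bc : nat -> nat -> nat -> R) (eta : nat -> nat -> nat -> R) :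
  strictly_incr r -> r O = 0 -> cv_infty r -> 0 < a -> a < b -> (1 <= n)%nat ->
  (forall m, (n <= m)%nat -> cb_basis r m (ln a) (ln b) (Bc m)) ->
  (forall m, (n <= m)%nat -> forall c, (c < s)%nat -> forall j, (j <= m)%nat ->
     curve_coefficients n A c j = comb (fun i => eta m i c) (Bc m) m j) ->
  cv_infty (fun N => sum_f_R0 (fun i => / r (S i)) N) ->
  ctrl_poly_unif_conv n a b (curve r n A) s eta.
Proof.
  intros Hr Hr0 Hinf Ha Hab Hn HB Heta Hsum.
  pose proof (ln_increasing a b Ha Hab) as Hln.
  assert (Hr1 : 0 < r 1%nat) by (rewrite <- Hr0; apply strictly_incr_lt; auto; lia).
  destruct (seq_choice _ (fun m xi => (n <= m)%nat ->
              forall i, (i <= m)%nat -> unit_vec 1 i = comb xi (Bc m) m i)) as [xi Hxi].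
  { intros m. destruct (Nat.le_gt_cases n m) as [Hm|Hm].
    - destruct (coefficients_exist r m (ln a) (ln b) (Bc m) (unit_vec 1) Hr Hln (HB m Hm))
        as [x Hx]. exists x. auto.
    - exists (fun _ => 0). lia. }
  assert (Hrange : forall m, (n <= m)%nat ->
            xi m O = exp (r 1%nat * ln a) /\ xi m m = exp (r 1%nat * ln b) /\
            (forall i, (i < m)%nat -> xi m i < xi m (S i)) /\
            (forall i, (i <= m)%nat ->
               exp (r 1%nat * ln a) <= xi m i <= exp (r 1%nat * ln b))).
  { intros m Hm. apply (first_power_range r m _ _ (Bc m)); auto. lia. }
  assert (Hnode : forall m i, (n <= m)%nat -> (i < m)%nat ->
            node r (xi m) i <= node r (xi m) (S i) <= ln b).
  { intros m i Hm Hi. destruct (Hrange m Hm) as [_ [_ [H1 H2]]]. split.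
    - unfold node, Rdiv. apply Rmult_le_compat_r; [left; apply Rinv_0_lt_compat; lra|].
      pose proof (exp_pos (r 1%nat * ln a)). specialize (H2 i ltac:(lia)).
      specialize (H1 i Hi). apply ln_le_ln; lra.
    - apply (ln_range (r 1%nat) (ln a) (ln b)); [exact Hr1|apply H2; lia]. }
  exists (fun m i => exp (node r (xi m) i)). split.
  - intros m Hm. destruct (Hrange m Hm) as [H0 [H1 _]].
    split; [|split].
    + unfold node. rewrite H0, ln_exp. rewrite <- (exp_ln a) at 2 by exact Ha.
      f_equal. field. lra.
    + unfold node. rewrite H1, ln_exp. rewrite <- (exp_ln b) at 2 by lra.
      f_equal. field. lra.
    + intros i Hi. apply exp_le_exp. apply Hnode; assumption.
  - intros eps Heps.
    (* [W] bounds the sum over k of |A_k| in every component at once; W + 1 keeps the quotient below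
       defined. *)
    set (W := sum_f_R0 (fun c => sum_f_R0 (fun k => Rabs (A k c)) n) s).
    assert (HW : 0 <= W).
    { apply sum_nonneg. intros c _. apply sum_nonneg. intros k _. apply Rabs_pos. }
    assert (He0 : 0 < eps / (W + 1)) by (apply Rdiv_lt_0_compat; lra).
    destruct (control_points_close r (ln a) (ln b) n _ Hr Hr0 Hinf Hsum Hln He0) as [M1 HM1].
    (* For x <= y <= ln b one has e^y - e^x <= e^y (y - x) <= b (y - x). *)
    assert (He1 : 0 < eps / b) by (apply Rdiv_lt_0_compat; lra).
    destruct (mesh_small r (ln a) (ln b) _ Hr Hr0 Hinf Hsum Hln He1) as [M2 HM2].
    exists (Nat.max M1 M2). intros m Hm HmM. split.
    + intros i Hi. destruct (Hnode m i Hm Hi) as [Hn1 Hn2].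
      specialize (HM2 m (Bc m) (xi m) ltac:(lia) (HB m Hm) (Hxi m Hm) i Hi).
      rewrite Rabs_right by (pose proof (exp_le_exp _ _ Hn1); lra).
      set (x := node r (xi m) i) in *. set (y := node r (xi m) (S i)) in *.
      apply exp_le_exp in Hn2. rewrite exp_ln in Hn2 by lra.
      assert (Ex : exp x = exp y * exp (- (y - x))) by (rewrite <- exp_plus; f_equal; ring).
      rewrite Ex. pose proof (exp_ineq1_le (- (y - x))). pose proof (exp_pos y).
      apply Rle_lt_trans with (exp y * (y - x)); [nra|].
      apply Rle_lt_trans with (b * (y - x)); [apply Rmult_le_compat_r; lra|].
      replace eps with (b * (eps / b)) by (field; lra). apply Rmult_lt_compat_l; lra.
    + intros i Hi. apply norm_inf_lt; [exact Heps|]. intros c Hc.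
      destruct (seq_choice _ (fun k co => forall j, (j <= m)%nat ->
                  unit_vec k j = comb co (Bc m) m j)) as [co Hco].
      { intros k. apply coefficients_exist with r (ln a) (ln b); auto. }
      (* Control points depend linearly on the curve, by uniqueness of coefficients, so closeness
         for the single powers suffices. *)
      assert (E : eta m i c = sum_f_R0 (fun k => A k c * co k i) n).
      { apply (coefficients_unique r m (ln a) (ln b) (Bc m) (fun i => eta m i c)
                 (fun i => sum_f_R0 (fun k => A k c * co k i) n) Hr Hln (HB m Hm));
          [|exact Hi].
        intros j Hj. rewrite <- Heta by assumption. unfold curve_coefficients, comb.
        rewrite (sum_eq _ (fun k => sum_f_R0 (fun i => A k c * co k i * Bc m i j) m)).
        - rewrite sum_swap. apply sum_eq. intros l _. rewrite sum_scal_r. reflexivity.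
        - intros k _. rewrite Hco by exact Hj. unfold comb. rewrite <- sum_scal_l.
          apply sum_eq. intros; ring. }
      rewrite E. unfold curve, Rpower. rewrite ln_exp, <- minus_sum.
      apply Rle_lt_trans with (sum_f_R0 (fun k => Rabs (A k c) * (eps / (W + 1))) n).
      * eapply Rle_trans; [apply Rsum_abs|]. apply sum_Rle. intros k Hk.
        replace (exp (r k * node r (xi m) i) * A k c - A k c * co k i)
          with (A k c * (exp (r k * node r (xi m) i) - co k i)) by ring.
        rewrite Rabs_mult. apply Rmult_le_compat_l; [apply Rabs_pos|].
        apply (HM1 m (Bc m) (xi m)); auto. lia.
      * rewrite sum_scal_r.
        assert (HWc : sum_f_R0 (fun k => Rabs (A k c)) n <= W).
        { unfold W.
          rewrite <- (sum_unit_vec (fun c => sum_f_R0 (fun k => Rabs (A k c)) n) c s) by lia.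
          apply sum_Rle. intros c' _.
          assert (0 <= sum_f_R0 (fun k => Rabs (A k c')) n)
            by (apply sum_nonneg; intros; apply Rabs_pos).
          unfold unit_vec. destruct (Nat.eq_dec c c'); lra. }
        apply Rle_lt_trans with (W * (eps / (W + 1))); [apply Rmult_le_compat_r; lra|].
        replace eps with ((W + 1) * (eps / (W + 1))) at 2 by (field; lra).
        apply Rmult_lt_compat_r; lra.
Qed.

Lemma mom_bounded (r : nat -> R) (m : nat) (c : nat -> R) (be : R) :
  strictly_incr r -> r O = 0 ->
  exists F, 0 <= F /\ forall v, v <= be -> Rabs (mom r m c 0 v) <= F.
Proof.
  intros Hr Hr0. exists (sum_f_R0 (fun j => Rabs (c j) * exp (r j * be)) m). split.
  - apply sum_nonneg. intros j _. apply Rmult_le_pos; [apply Rabs_pos|left; apply exp_pos].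
  - intros v Hv. eapply Rle_trans; [apply Rsum_abs|]. apply sum_Rle. intros j _.
    simpl. rewrite Rmult_1_r, Rabs_mult, (Rabs_right (exp _)) by (left; apply exp_pos).
    apply Rmult_le_compat_l; [apply Rabs_pos|]. apply exp_le_exp.
    apply Rmult_le_compat_l; [|exact Hv].
    destruct j as [|j]; [lra|]. left. rewrite <- Hr0. apply strictly_incr_lt; auto; lia.
Qed.

Lemma continuity_mom_ln (r : nat -> R) (m : nat) (c : nat -> R) (a eps : R) :
  0 < a -> 0 < eps ->
  exists d, 0 < d /\ forall t, a <= t -> t - a < d ->
    Rabs (mom r m c 0 (ln t) - mom r m c 0 (ln a)) < eps.
Proof.
  intros Ha Heps.
  assert (Hc : continuity_pt (fun t => mom r m c 0 (ln t)) a).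
  { apply (continuity_pt_comp ln (mom r m c 0)); [|apply continuity_mom].
    apply derivable_continuous_pt. exists (/ a). apply derivable_pt_lim_ln. exact Ha. }
  destruct (Hc eps Heps) as [d [Hd H]]. exists d. split; [exact Hd|].
  intros t Hat Htd. destruct (Req_dec t a) as [->|Hne].
  - rewrite Rminus_diag, Rabs_R0. exact Heps.
  - apply H. split; [split; [exact I|auto]|]. simpl. unfold Rdist.
    rewrite Rabs_right; lra.
Qed.

Lemma divergent_sum_of_polygons_converge (r : nat -> R) (a b : R) (n s : nat) (A : nat -> nat -> R)
    (Bc : nat -> nat -> nat -> R) (eta : nat -> nat -> nat -> R) (c : nat) :
  strictly_incr r -> r O = 0 -> cv_infty r -> 0 < a -> a < b ->
  (forall m, (n <= m)%nat -> cb_basis r m (ln a) (ln b) (Bc m)) ->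
  (forall m, (n <= m)%nat -> forall c, (c < s)%nat -> forall j, (j <= m)%nat ->
     curve_coefficients n A c j = comb (fun i => eta m i c) (Bc m) m j) ->
  (c < s)%nat -> (exists t1 t2, curve r n A t1 c <> curve r n A t2 c) ->
  ctrl_poly_unif_conv n a b (curve r n A) s eta ->
  cv_infty (fun N => sum_f_R0 (fun i => / r (S i)) N).
Proof.
  intros Hr Hr0 Hinf Ha Hab HB Heta Hc [t1 [t2 Hne]] [tt [Htt Hconv]].
  apply NNPP. intros Hnot.
  pose proof (inverse_sum_cauchy r Hr Hr0 Hnot) as Hcauchy.
  pose proof (ln_increasing a b Ha Hab) as Hln.
  set (f := curve_coefficients n A c).
  set (f0 := curve r n A a c).
  assert (Hconst : forall v, ln a < v < ln b -> mom r n f 0 v = f0).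
  { intros v Hv. apply cond_eq. intros eps0 Heps0.
    destruct (mom_bounded r n f (ln b) Hr Hr0) as [F [HF0 HF]].
    (* [C] bounds |eta_i - P(a)|: two values of P, each at most F, and a distance at most 1 from the
       curve. The final estimate is 2 eps from the indices below K plus C eps from the others, less
       than (C + 3) eps = eps0. *)
    set (C := 2 * F + 1).
    set (eps := eps0 / (C + 3)).
    assert (Heps : 0 < eps) by (apply Rdiv_lt_0_compat; unfold C; lra).
    destruct (bernstein_mass_tight r (ln a) (ln b) v eps Hr Hr0 Hinf ltac:(lra) Heps Hcauchy)
      as [K HK].
    destruct (continuity_mom_ln r n f a eps Ha Heps) as [d [Hd Hcont]].
    (* With steps below d / (K + 1), the nodes of index less than K stay within d of a, whatever m
       is. *)
    set (mesh := Rmin (d / INR (S K)) (Rmin eps 1)).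
    assert (HSK : 0 < INR (S K)) by (apply lt_0_INR; lia).
    assert (Hmesh : 0 < mesh).
    { repeat apply Rmin_glb_lt; try lra. apply Rdiv_lt_0_compat; assumption. }
    assert (Hm1 : mesh <= d / INR (S K)) by apply Rmin_l.
    assert (Hm2 : mesh <= eps) by (eapply Rle_trans; [apply Rmin_r|apply Rmin_l]).
    assert (Hm3 : mesh <= 1) by (eapply Rle_trans; [apply Rmin_r|apply Rmin_r]).
    destruct (Hconv mesh Hmesh) as [N HN].
    set (m := (n + N + K)%nat).
    destruct (HN m ltac:(unfold m; lia) ltac:(unfold m; lia)) as [HN1 HN2].
    destruct (Htt m ltac:(unfold m; lia)) as [Hta [Htb Htmono]].
    pose proof (nondecreasing_seq (tt m) m Htmono) as Hmono.
    specialize (HK m (Bc m) ltac:(unfold m; lia) (HB m ltac:(unfold m; lia))).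
    specialize (HB m ltac:(unfold m; lia)).
    assert (Hclose : forall i, (i <= m)%nat -> Rabs (curve r n A (tt m i) c - eta m i c) < mesh).
    { intros i Hi. specialize (HN2 i Hi).
      rewrite norm_inf_lt in HN2 by exact Hmesh. apply HN2. exact Hc. }
    assert (Hbound : forall i, (i <= m)%nat -> Rabs (eta m i c - f0) <= C).
    { intros i Hi. specialize (Hclose i Hi).
      assert (Hti : a <= tt m i <= b).
      { rewrite <- Hta, <- Htb. split; apply Hmono; lia. }
      pose proof (HF (ln (tt m i)) (ln_le_ln (tt m i) b ltac:(lra) ltac:(lra))) as H1.
      pose proof (HF (ln a) ltac:(lra)) as H2.
      rewrite <- (curve_mom r n n A c) in H1, H2 by lia. fold f0 in H2.
      unfold C. apply Rabs_def2 in Hclose. unfold Rabs in *.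
      repeat destruct Rcase_abs; lra. }
    assert (Hnear : forall i, (i <= m)%nat -> (i < K)%nat -> Rabs (eta m i c - f0) <= 2 * eps).
    { intros i Hi HiK. specialize (Hclose i Hi).
      assert (Hstep : forall i, (i <= m)%nat -> tt m i - a <= INR i * mesh).
      { induction i0 as [|i0 IH]; intros Hi0; [rewrite Hta; simpl; lra|].
        specialize (IH ltac:(lia)). specialize (HN1 i0 ltac:(lia)).
        apply Rabs_def2 in HN1. rewrite S_INR. lra. }
      assert (Hlt : tt m i - a < d).
      { apply Rle_lt_trans with (INR i * mesh); [apply Hstep; exact Hi|].
        apply Rlt_le_trans with (INR (S K) * mesh).
        - apply Rmult_lt_compat_r; [exact Hmesh|apply lt_INR; lia].
        - replace d with (INR (S K) * (d / INR (S K))) by (field; lra).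
          apply Rmult_le_compat_l; lra. }
      specialize (Hcont (tt m i) ltac:(rewrite <- Hta; apply Hmono; lia) Hlt).
      unfold f in Hcont. rewrite <- !(curve_mom r n n A c) in Hcont by lia. fold f0 in Hcont.
      apply Rabs_def2 in Hcont, Hclose. apply Rabs_le. lra. }
    assert (Ev : mom r n f 0 v = sum_f_R0 (fun i => eta m i c * mom r m (Bc m i) 0 v) m).
    { transitivity (mom r m f 0 v).
      - rewrite <- (ln_exp v). unfold f. rewrite <- !curve_mom by (unfold m; lia). reflexivity.
      - apply comb_mom_eq. apply Heta; [unfold m; lia|exact Hc]. }
    pose proof (cb_basis_sum r m _ _ _ 0 v HB) as E1.
    rewrite Hr0, Rmult_0_l, exp_0 in E1. simpl in E1. rewrite Rmult_1_l in E1.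
    assert (Ed : mom r n f 0 v - f0
                 = sum_f_R0 (fun i => (eta m i c - f0) * mom r m (Bc m i) 0 v) m).
    { rewrite Ev. rewrite <- (Rmult_1_r f0) at 1. rewrite <- E1, <- sum_scal_l, <- minus_sum.
      apply sum_eq. intros; ring. }
    rewrite Ed.
    apply Rle_lt_trans with (sum_f_R0 (fun i => 2 * eps * mom r m (Bc m i) 0 v
      + C * ((if Nat.leb K i then 1 else 0) * mom r m (Bc m i) 0 v)) m).
    - eapply Rle_trans; [apply Rsum_abs|]. apply sum_Rle. intros i Hi.
      pose proof (cb_basis_nonneg r m (ln a) (ln b) (Bc m) i v Hr Hln HB Hi ltac:(lra)) as Hp.
      rewrite Rabs_mult, (Rabs_right (mom _ _ _ _ _)) by lra.
      destruct (Nat.leb_spec K i) as [HKi|HKi].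
      + specialize (Hbound i Hi). nra.
      + specialize (Hnear i Hi HKi). nra.
    - rewrite plus_sum, !sum_scal_l, E1.
      assert (HC : 0 < C) by (unfold C; lra).
      assert (C * sum_f_R0 (fun i => (if Nat.leb K i then 1 else 0) * mom r m (Bc m i) 0 v) m
              <= C * eps) by (apply Rmult_le_compat_l; lra).
      replace eps0 with ((C + 3) * eps) by (unfold eps; field; lra). lra. }
  (* The zero count turns constancy on (a, b) into an identity of coefficients, hence constancy
     everywhere. *)
  assert (Hcoef : forall j, (j <= n)%nat -> f j + (- f0) * unit_vec O j = 0).
  { apply (zero_on_interval r n (fun j => f j + (- f0) * unit_vec O j) (ln a) (ln b) Hr Hln).
    intros v Hv. rewrite mom_plus, mom_scal, (Hconst v Hv), mom_unit_vec by lia.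
    rewrite Hr0, Rmult_0_l, exp_0. ring. }
  assert (Hall : forall t, curve r n A t c = f0).
  { intros t. rewrite (curve_mom r n n) by lia. fold f.
    rewrite (mom_ext r n f (fun j => f0 * unit_vec O j)).
    - rewrite mom_scal, mom_unit_vec, Hr0, Rmult_0_l, exp_0 by lia. ring.
    - intros j Hj. specialize (Hcoef j Hj). lra. }
  apply Hne. rewrite !Hall. reflexivity.
Qed.

Theorem theorem1
  (r : nat -> R)
  (Hr0 : r O = 0)
  (Hrinc : forall i, r i < r (S i))
  (Hrinf : cv_infty r)
  (a b : R) (Ha : 0 < a) (Hab : a < b)
  (n : nat) (Hn : (1 <= n)%nat)
  (s : nat) (Hs : (1 <= s)%nat)
  (A : nat -> nat -> R)
  (Hnc : exists t1 t2, 0 < t1 /\ 0 < t2 /\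
           exists c, (c < s)%nat /\ curve r n A t1 c <> curve r n A t2 c)
  (Bc : nat -> nat -> nat -> R)
  (HB : forall m, (n <= m)%nat -> IsCBBasis r a b m (Bc m))
  (eta : nat -> nat -> nat -> R)
  (Heta : forall m, (n <= m)%nat -> forall t, 0 < t -> forall c, (c < s)%nat ->
            curve r n A t c =
            sum_f_R0 (fun i => muntz_fun r m (Bc m i) t * eta m i c) m) :
  ctrl_poly_unif_conv n a b (curve r n A) s eta <->
  cv_infty (fun N => sum_f_R0 (fun i => / r (S i)) N).
Proof.
  assert (HB' : forall m, (n <= m)%nat -> cb_basis r m (ln a) (ln b) (Bc m)).
  { intros m Hm. apply cb_basis_of_IsCBBasis; auto. }
  assert (Heta' : forall m, (n <= m)%nat -> forall c, (c < s)%nat -> forall j, (j <= m)%nat ->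
     curve_coefficients n A c j = comb (fun i => eta m i c) (Bc m) m j).
  { intros m Hm c Hc. apply (coefficients_of_function r m); [exact Hrinc|]. intros v.
    rewrite mom_comb, <- (ln_exp v), <- curve_mom by exact Hm.
    rewrite (Heta m Hm (exp v) (exp_pos v) c Hc). apply sum_eq. intros i _.
    rewrite muntz_fun_mom. ring. }
  split.
  - destruct Hnc as [t1 [t2 [_ [_ [c [Hc Hne]]]]]].
    apply (divergent_sum_of_polygons_converge r a b n s A Bc eta c); auto.
    exists t1, t2. exact Hne.
  - apply (polygons_converge_of_divergent_sum r a b n s A Bc eta); auto.
Qed.
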